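(* Assume (A1) and (A2). Let $\bar Z\in\mathcal{Z}_\star$, $\bar H\in\mathcal{C}(\bar Z)$ and $W^{(0)}\in\mathbb{S}^n$, and define $$W^{(k+1)}:=W^{(k)}+\delta''(\bar Z;\bar H,W^{(k)}).$$ Then the limits $$\phi_X(\bar Z;\bar H):=\lim_{k\to\infty}\big(\Pi_+''(\bar Z;\bar H,W^{(k+1)})-\Pi_+''(\bar Z;\bar H,W^{(k)})\big),$$ $$\phi_S(\bar Z;\bar H):=-\frac{1}{\sigma}\lim_{k\to\infty}\big(\Pi_-''(\bar Z;\bar H,W^{(k+1)})-\Pi_-''(\bar Z;\bar H,W^{(k)})\big)$$ exist and satisfy $$\phi_X(\bar Z;\bar H)=\Theta_{\bar H}(\phi(\bar Z;\bar H)),\qquad \phi_S(\bar Z;\bar H)=-\frac{1}{\sigma}\Theta^\perp_{\bar H}(\phi(\bar Z;\bar H)),\qquad \phi(\bar Z;\bar H)=\phi_X(\bar Z;\bar H)-\sigma\phi_S(\bar Z;\bar H).$$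
   Context: Notation: $\mathbb{S}^n$ is the space of real symmetric $n\times n$ matrices with $\langle A,B\rangle=\mathrm{tr}(AB)$. $\Pi_+$, $\Pi_-$ are the orthogonal projections onto the PSD and NSD cones. For $F\in\{\Pi_+,\Pi_-\}$: $$F'(Z;H):=\lim_{t\downarrow0}\frac{F(Z+tH)-F(Z)}{t},\qquad F''(Z;H,W):=\lim_{t\downarrow0}\frac{F(Z+tH+\tfrac{t^2}{2}W)-F(Z)-tF'(Z;H)}{t^2/2}.$$ SDP data $C,A_1,\dots,A_m\in\mathbb{S}^n$, $b\in\mathbb{R}^m$ define $\mathcal{A}X:=(\langle A_i,X\rangle)_i$ and $\mathcal{A}^*y:=\sum_iy_iA_i$. A KKT point is $(X,y,S)$ with $\mathcal{A}X=b$, $\mathcal{A}^*y+S=C$, $X,S\succeq0$, $\langle X,S\rangle=0$. $\mathcal{X}_\star$, $\mathcal{S}_\star$ are the sets of $X$, resp. $S$, in KKT points. (A1) $\mathcal{A}$ is surjective. (A2) Some KKT point $(X_{sc},y_{sc},S_{sc})$ has $\mathrm{rank}X_{sc}+\mathrm{rank}S_{sc}=n$. Let $\mathcal{P}:=\mathcal{A}^*(\mathcal{A}\mathcal{A}^* )^{-1}\mathcal{A}$ and $\mathcal{P}^\perp:=\mathrm{Id}-\mathcal{P}$. Fix $\sigma>0$ and let $\mathcal{Z}_\star:=\{X-\sigma S:X\in\mathcal{X}_\star,S\in\mathcal{S}_\star\}$. For $\bar Z\in\mathcal{Z}_\star$: $$\delta'(\bar Z;H):=-\mathcal{P}\Pi_+'(\bar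 Z;H)-\mathcal{P}^\perp\Pi_-'(\bar Z;H),\qquad \delta''(\bar Z;H,W):=-\mathcal{P}\Pi_+''(\bar Z;H,W)-\mathcal{P}^\perp\Pi_-''(\bar Z;H,W),$$ and $\mathcal{C}(\bar Z):=\{H:\delta'(\bar Z;H)=0\}$. Let $P_0$ be the projector onto $\ker\bar Z$ and $\bar Z^\dagger$ the Moore–Penrose pseudoinverse. For $\bar H\in\mathcal{C}(\bar Z)$ let $\Upsilon:=2P_0\bar H\bar Z^\dagger\bar HP_0$ and $$\Theta_{\bar H}(V):=\Pi_+''(\bar Z;\bar H,V+\Upsilon)-\Pi_+''(\bar Z;\bar H,\Upsilon),\qquad \Theta^\perp_{\bar H}(V):=\Pi_-''(\bar Z;\bar H,V+\Upsilon)-\Pi_-''(\bar Z;\bar H,\Upsilon).$$ Let $\Psi:=\delta''(\bar Z;\bar H,\Upsilon)$ and $\mathcal{K}:=\mathrm{cl}\{\mathcal{P}\Theta_{\bar H}(V)+\mathcal{P}^\perp\Theta^\perp_{\bar H}(V):V\in\mathbb{S}^n\}$, a closed convex cone. Then $\phi(\bar Z;\bar H):=\Psi-\Pi_{\mathcal{K}}(\Psi)$. *)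

(* Defs.v *)
From HB Require Import structures.
From mathcomp Require Import all_boot all_order all_algebra.
From mathcomp Require Import all_classical all_reals all_analysis.
Import Order.TTheory GRing.Theory Num.Theory.
Import numFieldNormedType.Exports.
Local Open Scope classical_set_scope.
Local Open Scope ring_scope.

Set Implicit Arguments.
Unset Strict Implicit.
Unset Printing Implicit Defensive.

Section SDPDefs.
Variables (R : realType) (n m : nat).
Implicit Types (X Y Z H W V : 'M[R]_n).

Definition ip X Y : R := \tr (X *m Y).

Definition sqnorm X : R := \tr (X^T *m X).

Definition sym X : Prop := X^T = X.

Definition psd X : Prop :=
  sym X /\ forall v : 'cV[R]_n, 0 <= (v^T *m X *m v) 0 0.

Definition nsd X : Prop := psd (- X).

Definition proj (C : set 'M[R]_n) Z : 'M[R]_n :=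
  xget 0 [set X | C X /\ forall Y, C Y -> sqnorm (Z - X) <= sqnorm (Z - Y)].

Definition PiP Z := proj psd Z.
Definition PiN Z := proj nsd Z.

Definition dd (F : 'M[R]_n -> 'M[R]_n) Z H : 'M[R]_n :=
  lim ((fun t : R => t^-1 *: (F (Z + t *: H) - F Z)) x @[x --> 0^'+]).

Definition dd2 (F : 'M[R]_n -> 'M[R]_n) Z H W : 'M[R]_n :=
  lim ((fun t : R => (t ^+ 2 / 2)^-1 *:
          (F (Z + t *: H + (t ^+ 2 / 2) *: W) - F Z - t *: dd F Z H))
         x @[x --> 0^'+]).

Variable A : 'I_m -> 'M[R]_n.

Definition Aop X : 'cV[R]_m := \col_i ip (A i) X.
Definition Aadj (y : 'cV[R]_m) : 'M[R]_n := \sum_i y i 0 *: A i.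
Definition AAadj : 'M[R]_m := \matrix_(i, j) ip (A i) (A j).

Definition Pop X : 'M[R]_n := Aadj (invmx AAadj *m Aop X).
Definition Pperp X : 'M[R]_n := X - Pop X.

Definition KKT (b : 'cV[R]_m) C X (y : 'cV[R]_m) S : Prop :=
  [/\ Aop X = b, Aadj y + S = C, psd X, psd S & ip X S = 0].

Definition Xstar b C X : Prop := exists y S, KKT b C X y S.
Definition Sstar b C S : Prop := exists X y, KKT b C X y S.
Definition Zstar b C (sigma : R) Z : Prop :=
  exists X S, [/\ Xstar b C X, Sstar b C S & Z = X - sigma *: S].

Definition delta1 Z H : 'M[R]_n := - Pop (dd PiP Z H) - Pperp (dd PiN Z H).
Definition delta2 Z H W : 'M[R]_n :=
  - Pop (dd2 PiP Z H W) - Pperp (dd2 PiN Z H W).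

Definition critcone Z H : Prop := sym H /\ delta1 Z H = 0.

Definition pinv Z : 'M[R]_n :=
  xget 0 [set X | [/\ Z *m X *m Z = Z, X *m Z *m X = X,
                     (Z *m X)^T = Z *m X & (X *m Z)^T = X *m Z]].

Definition kerproj Z : 'M[R]_n :=
  xget 0 [set P | [/\ P^T = P, P *m P = P & (P == kermx Z)%MS]].

Definition Upsilon Z H : 'M[R]_n :=
  2%:R *: (kerproj Z *m H *m pinv Z *m H *m kerproj Z).

Definition Theta Z H V : 'M[R]_n :=
  dd2 PiP Z H (V + Upsilon Z H) - dd2 PiP Z H (Upsilon Z H).
Definition Thetaperp Z H V : 'M[R]_n :=
  dd2 PiN Z H (V + Upsilon Z H) - dd2 PiN Z H (Upsilon Z H).

Definition Psi Z H : 'M[R]_n := delta2 Z H (Upsilon Z H).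

Definition Kcone Z H : set 'M[R]_n :=
  closure [set Pop (Theta Z H V) + Pperp (Thetaperp Z H V) | V in sym].

Definition phi Z H : 'M[R]_n := Psi Z H - proj (Kcone Z H) (Psi Z H).

End SDPDefs.

(* Main.v *)
(* Moreau's decomposition characterizes the projection onto the PSD cone, and it
   is stable: if [X] and [Y] are PSD and almost orthogonal, then [X] is almost
   the projection of [X - Y].  Block-diagonalizing [Z + t H + t^2/2 W] by an
   almost orthogonal matrix [U t], up to [O(t^3)], therefore yields the
   second-order expansion of the projection.  Its dependence on [W] is linear
   except on the kernel block, where the shift [Upsilon] centres it; so [Theta]
   is positively homogeneous, and firmly nonexpansive as a limit of firmly
   nonexpansive maps.

   Put [M V = P (Theta V) + P^perp (Thetaperp V)], again firmly nonexpansive and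
   homogeneous.  With [V k = W k - Upsilon] the iteration reads
   [V (k+1) = V k + (Psi - M (V k))].  The solutions [p] of [p + a M p = Psi]
   converge, as [a] tends to infinity, to some [X] with [M X = 0] and
   [<X, Psi - X - M u> >= 0] for all [u], which says that
   [X = Psi - Proj_K Psi = phi].  The increments of any two orbits merge, and
   orbits started at [a p] have increments close to [X] from the start, so
   [Psi - M (V k)] tends to [X].  Finally [M X = 0] gives
   [P (Theta X) = 0] and [P^perp (Thetaperp X) = 0], which identifies the limits. *)
Require Import Defs.
From HB Require Import structures.
From mathcomp Require Import all_boot all_order all_algebra.
From mathcomp Require Import all_classical all_reals all_analysis.
From mathcomp.real_closed Require complex.
From mathcomp Require Import ring lra.
Import Order.TTheory GRing.Theory Num.Theory.
Import numFieldNormedType.Exports.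
Local Open Scope classical_set_scope.
Local Open Scope ring_scope.

Set Implicit Arguments.
Unset Strict Implicit.
Unset Printing Implicit Defensive.

(** [proj], [pinv] and [kerproj] are chosen by [xget] and the derivatives by [lim]; both return a
    default when nothing qualifies. So every value is pinned down by uniqueness, or by an expansion
    whose error is a full power of [t] smaller than the last term kept.

    The stability estimate bounds a squared distance by an inner product, so an error O(t^3) in the
    projection requires an inner product O(t^6). It is available because the exact blocks are
    orthogonal: only a term quadratic in the defect of U^T U from the identity remains.

    [Psi - phi] may be only a limit of values of [M], so no preimage of it is at hand. Resolvents
    replace the preimage: by homogeneity p + a M p = Psi reads M (a p) = Psi - p, so the orbit
    started at [a p] has first increment exactly [p]. *)

Ltac mx_ring := apply/matrixP => ? ?; rewrite !mxE; first [ring | by field].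

(** * Symmetric and positive semidefinite matrices *)

Section InnerProduct.
Variables (R : realType) (n : nat).
Implicit Types (X Y Z : 'M[R]_n).

Lemma sqnorm_sum X : sqnorm X = \sum_i \sum_j X i j ^+ 2.
Proof.
rewrite /sqnorm /mxtrace exchange_big /=.
apply: eq_bigr => i _; rewrite mxE; apply: eq_bigr => j _.
by rewrite mxE expr2.
Qed.

Lemma sqnorm_ip X : sym X -> sqnorm X = ip X X.
Proof. by rewrite /sqnorm /ip => ->. Qed.

Lemma sqnorm_ge0 X : 0 <= sqnorm X.
Proof. by rewrite sqnorm_sum; do 2!apply: sumr_ge0 => ? _; exact: sqr_ge0. Qed.

Lemma entry_sqnorm X i j : X i j ^+ 2 <= sqnorm X.
Proof.
rewrite sqnorm_sum (bigD1 i) //= (bigD1 j) //= -addrA lerDl addr_ge0 //.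
  by apply: sumr_ge0 => k _; apply: sqr_ge0.
by apply: sumr_ge0 => k _; apply: sumr_ge0 => l _; apply: sqr_ge0.
Qed.

Lemma sqnorm_eq0 X : sqnorm X <= 0 -> X = 0.
Proof.
move=> X0; apply/matrixP => i j; rewrite mxE; apply/eqP; rewrite -sqrf_eq0 eq_le sqr_ge0 andbT.
exact: le_trans (entry_sqnorm X i j) X0.
Qed.

Lemma ipC X Y : ip X Y = ip Y X.
Proof. exact: mxtrace_mulC. Qed.

Lemma ipDl X Y Z : ip (X + Y) Z = ip X Z + ip Y Z.
Proof. by rewrite /ip mulmxDl mxtraceD. Qed.

Lemma ipZl a X Y : ip (a *: X) Y = a * ip X Y.
Proof. by rewrite /ip -scalemxAl mxtraceZ. Qed.

Lemma ipNl X Y : ip (- X) Y = - ip X Y.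
Proof. by rewrite /ip mulNmx raddfN. Qed.

Lemma ipDr X Y Z : ip Z (X + Y) = ip Z X + ip Z Y.
Proof. by rewrite ipC ipDl !(ipC Z). Qed.

Lemma ipNr X Y : ip X (- Y) = - ip X Y.
Proof. by rewrite ipC ipNl ipC. Qed.

Lemma ipZr a X Y : ip X (a *: Y) = a * ip X Y.
Proof. by rewrite ipC ipZl ipC. Qed.

Definition ipE := (ipDl, ipDr, ipNl, ipNr, ipZl, ipZr).

Lemma symD X Y : sym X -> sym Y -> sym (X + Y).
Proof. by move=> sX sY; rewrite /sym linearD /= sX sY. Qed.

Lemma symN X : sym X -> sym (- X).
Proof. by move=> sX; rewrite /sym linearN /= sX. Qed.

Lemma symB X Y : sym X -> sym Y -> sym (X - Y).
Proof. by move=> sX sY; apply: symD => //; apply: symN. Qed.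

Lemma symZ a X : sym X -> sym (a *: X).
Proof. by move=> sX; rewrite /sym linearZ /= sX. Qed.

Lemma sym0 : sym (0 : 'M[R]_n).
Proof. by rewrite /sym trmx0. Qed.

Lemma sym1 : sym (1%:M : 'M[R]_n).
Proof. by rewrite /sym trmx1. Qed.

Lemma sym_sum I (r : seq I) (P : pred I) (F : I -> 'M[R]_n) :
  (forall i, P i -> sym (F i)) -> sym (\sum_(i <- r | P i) F i).
Proof.
by move=> sF; rewrite /sym raddf_sum /=; apply: eq_bigr => i /sF.
Qed.

Lemma sym_conj X Y : sym Y -> sym (X *m Y *m X^T).
Proof. by move=> sY; rewrite /sym !trmx_mul trmxK sY mulmxA. Qed.

Lemma sym_conj_sym X Y : sym X -> sym Y -> sym (X *m Y *m X).
Proof. by move=> sX sY; rewrite /sym !trmx_mul sY sX mulmxA. Qed.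

Lemma sqnormB X Y : sym X -> sym Y ->
  sqnorm (X - Y) = sqnorm X - 2 * ip X Y + sqnorm Y.
Proof.
move=> sX sY; rewrite !sqnorm_ip //; last exact: symB.
by rewrite !ipE (ipC Y X); ring.
Qed.

Lemma sqnormZ a X : sqnorm (a *: X) = a ^+ 2 * sqnorm X.
Proof.
rewrite !sqnorm_sum mulr_sumr; apply: eq_bigr => i _; rewrite mulr_sumr.
by apply: eq_bigr => j _; rewrite mxE exprMn.
Qed.

Lemma sqnormN X : sqnorm (- X) = sqnorm X.
Proof. by rewrite -scaleN1r sqnormZ sqrrN expr1n mul1r. Qed.

Lemma psdD X Y : psd X -> psd Y -> psd (X + Y).
Proof.
move=> [sX pX] [sY pY]; split; first exact: symD.
by move=> v; rewrite mulmxDr mulmxDl mxE addr_ge0.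
Qed.

Lemma psdZ a X : 0 <= a -> psd X -> psd (a *: X).
Proof.
move=> a0 [sX pX]; split; first exact: symZ.
by move=> v; rewrite -scalemxAr -scalemxAl mxE mulr_ge0.
Qed.

Lemma psd0 : psd (0 : 'M[R]_n).
Proof. by split=> [|v]; [exact: sym0 | rewrite mulmx0 mul0mx mxE]. Qed.

Lemma psd_sum I (r : seq I) (P : pred I) (F : I -> 'M[R]_n) :
  (forall i, P i -> psd (F i)) -> psd (\sum_(i <- r | P i) F i).
Proof.
by move=> pF; elim/big_ind: _ => //; [exact: psd0 | exact: psdD].
Qed.

Lemma psd_conj X Y : psd Y -> psd (X *m Y *m X^T).
Proof.
move=> [sY pY]; split; first exact: sym_conj.
by move=> v; have := pY (X^T *m v); rewrite trmx_mul trmxK !mulmxA.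
Qed.

Lemma psd_conj_sym X Y : sym X -> psd Y -> psd (X *m Y *m X).
Proof. by move=> sX /(psd_conj X); rewrite sX. Qed.

Lemma psd1 : psd (1%:M : 'M[R]_n).
Proof.
split=> [|v]; first exact: sym1.
rewrite mulmx1 mxE; apply: sumr_ge0 => i _; rewrite mxE -expr2; exact: sqr_ge0.
Qed.

Lemma psd_idem X : sym X -> X *m X = X -> psd X.
Proof. by move=> sX <-; rewrite -{1}[X]mulmx1; apply/psd_conj_sym/psd1. Qed.

Lemma psd_trace_ge0 X : psd X -> 0 <= \tr X.
Proof.
move=> [_ pX]; apply: sumr_ge0 => i _.
have := pX (delta_mx i 0); rewrite trmx_delta -rowE -colE.
by rewrite !mxE.
Qed.

End InnerProduct.

(** * Spectral theorem *)

(** With projectors instead of eigenvectors, functions of [Z] are sums [\sum_i a i *: E i],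
    multiplied coefficientwise. Repeated [d i] and zero [E i] are allowed. *)
Record spectral_resolution (R : realType) (n k : nat) (Z : 'M[R]_n)
    (d : 'I_k -> R) (E : 'I_k -> 'M[R]_n) : Prop := SpectralResolution {
  sr_sym : forall i, sym (E i);
  sr_idem : forall i, E i *m E i = E i;
  sr_orth : forall i j, i != j -> E i *m E j = 0;
  sr_one : \sum_i E i = 1%:M;
  sr_eq : Z = \sum_i d i *: E i }.

Section SpectralTheorem.
Variable R : realType.
Import complex.

(** Over the complex numbers [Z] is hermitian, hence diagonalizable with real spectrum, and
    [real_similar] descends the similarity to a real base change. [P] is only known to be
    invertible; orthogonality is recovered in the next lemma. *)
Lemma sym_diagonalizable n (Z : 'M[R]_n) : sym Z ->
  exists (P : 'M[R]_n) (d : 'rV[R]_n), P \in unitmx /\ P *m Z = diag_mx d *m P.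
Proof.
move=> sZ.
pose f := GRing.RMorphism.clone _ _ (real_complex R) _.
have realf m p (B : 'M[R]_(m, p)) : map_mx f B \is a realmx.
  by apply/mxOverP => i j; rewrite mxE complex_real.
have unreal m p (B : 'M[R[i]]_(m, p)) : B \is a realmx -> exists C, B = map_mx f C.
  move=> /mxOverP rB; exists (map_mx (@Re R) B); apply/matrixP => i j.
  by rewrite !mxE /= RRe_real.
have hA : map_mx f Z \is hermsymmx.
  apply: realsym_hermsym (realf _ _ _).
  apply/is_hermitianmxP; rewrite expr0 scale1r (map_mx_id (f := idfun)) //.
  by apply/matrixP => i j; rewrite !mxE -{1}sZ mxE.
have rsp := hermitian_spectral_diag_real hA.
have /orthomx_spectralP Aeq := hermitian_normalmx hA.
have Uu := spectral_unit (map_mx f Z).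
have [d dE] := unreal _ _ _ rsp.
have sim : similar_in unitmx (map_mx f Z) (map_mx f (diag_mx d)).
  exists (spectralmx (map_mx f Z)) => //; apply/similarP => //.
  by rewrite map_diag_mx -dE {2}Aeq -!mulmxA mulKVmx.
have [P /andP[rP uP]] := real_similar sim (realf _ _ _) (realf _ _ _).
move=> /(similarP uP); have [Q QE] := unreal _ _ _ rP.
move: uP; rewrite QE map_unitmx => uQ; rewrite -!map_mxM => /map_mx_inj e.
by exists Q, d.
Qed.

(** Since [P] need not be orthogonal, projectors onto single eigenlines could be oblique. Grouping
    equal eigenvalues with [undup] gives projectors onto full eigenspaces; these spaces are mutually
    orthogonal, which forces each projector to be symmetric. *)
Lemma spectral_resolution_exists n (Z : 'M[R]_n) : sym Z ->
  exists k (d : 'I_k -> R) (E : 'I_k -> 'M[R]_n), spectral_resolution Z d E.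
Proof.
move=> sZ; have [P [d [uP PZ]]] := sym_diagonalizable sZ.
pose s := undup [seq d 0 j | j : 'I_n].
pose fc (g : R -> R) := invmx P *m diag_mx (\row_j g (d 0 j)) *m P.
have fcM g h : fc g *m fc h = fc (fun x => g x * h x).
  rewrite /fc !mulmxA -(mulmxA (invmx P *m _)) mulmxV // mulmx1.
  rewrite -(mulmxA (invmx P)) mulmx_diag; congr (_ *m diag_mx _ *m _).
  by apply/rowP => j; rewrite !mxE.
have fcS (I : finType) (g : I -> R -> R) :
    \sum_i fc (g i) = fc (fun x => \sum_i g i x).
  rewrite /fc -mulmx_suml -mulmx_sumr -raddf_sum; congr (_ *m diag_mx _ *m _).
  by apply/rowP => j; rewrite summxE !mxE; apply: eq_bigr => i _; rewrite mxE.
have fcZ a g : a *: fc g = fc (fun x => a * g x).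
  rewrite /fc scalemxAl scalemxAr -linearZ; congr (_ *m diag_mx _ *m _).
  by apply/rowP => j; rewrite !mxE.
have fc_ext g h : (forall j, g (d 0 j) = h (d 0 j)) -> fc g = fc h.
  move=> gh; rewrite /fc; congr (_ *m diag_mx _ *m _).
  by apply/rowP => j; rewrite !mxE.
have fc1 : fc (fun=> 1) = 1%:M.
  rewrite /fc; have -> : \row_j 1 = const_mx 1 :> 'rV[R]_n by apply/rowP => j; rewrite !mxE.
  by rewrite diag_const_mx mulmx1 mulVmx.
have fcid : fc id = Z.
  rewrite /fc; have -> : \row_j id (d 0 j) = d by apply/rowP => j; rewrite !mxE.
  by rewrite -mulmxA -PZ mulKmx.
pose dd (i : 'I_(size s)) := s`_i.
pose E i := fc (fun x => (x == dd i)%:R).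
have us : uniq s by apply: undup_uniq.
have ddI i j : (dd i == dd j) = (i == j) by rewrite nth_uniq.
have sel (g : R -> R) j : \sum_i g (dd i) * (d 0 j == dd i)%:R = g (d 0 j).
  have js : d 0 j \in s by rewrite mem_undup; apply/mapP; exists j; rewrite ?mem_enum.
  have hi : (index (d ord0 j) s < size s)%N by rewrite index_mem.
  have di : dd (Ordinal hi) = d 0 j by rewrite /dd nth_index.
  rewrite (bigD1 (Ordinal hi)) //= di eqxx mulr1 big1 ?addr0 // => i.
  by rewrite -ddI di eq_sym => /negPf->; rewrite mulr0.
have Eidem i : E i *m E i = E i.
  by rewrite fcM; apply: fc_ext => j; case: eqP; rewrite ?mulr1 ?mulr0.
have Eorth i j : i != j -> E i *m E j = 0.
  move=> ij; rewrite fcM -(scale0r (fc (fun=> 0))) fcZ.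
  apply: fc_ext => l; case: eqP => [->|]; last by rewrite !mul0r.
  by rewrite ddI (negPf ij) mulr0 mul0r.
have E1 : \sum_i E i = 1%:M.
  rewrite fcS -fc1; apply: fc_ext => j; rewrite -[RHS](sel (fun=> 1) j).
  by apply: eq_bigr => i _; rewrite mul1r.
have ZE : Z = \sum_i dd i *: E i.
  rewrite -[LHS]fcid (eq_bigr _ (fun i _ => fcZ _ _)) fcS.
  by apply: fc_ext => j; rewrite -[LHS](sel id j).
exists (size s), dd, E; split=> // i.
have ZEi j : Z *m E j = dd j *: E j.
  rewrite ZE mulmx_suml (bigD1 j) //= big1 => [|l lj].
    by rewrite -scalemxAl Eidem addr0.
  by rewrite -scalemxAl Eorth // scaler0.
(* Eigenspaces of a symmetric matrix are orthogonal. *)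
have orthT j : i != j -> (E i)^T *m E j = 0.
  move=> ij; have : (Z *m E i)^T *m E j = (E i)^T *m (Z *m E j).
    by rewrite trmx_mul sZ -mulmxA.
  rewrite !ZEi linearZ /= -scalemxAl -scalemxAr => /eqP.
  rewrite -subr_eq0 -scalerBl scaler_eq0 subr_eq0 ddI (negPf ij) /=.
  by move/eqP.
have EiT : (E i)^T = (E i)^T *m E i.
  rewrite -[LHS]mulmx1 -E1 mulmx_sumr (bigD1 i) //= big1 ?addr0 // => j ji.
  by apply: orthT; rewrite eq_sym.
have := congr1 trmx EiT; rewrite trmxK trmx_mul trmxK /sym => e.
by rewrite EiT -e.
Qed.

End SpectralTheorem.

Section Resolution.
Variables (R : realType) (n k : nat) (Z : 'M[R]_n).
Variables (d : 'I_k -> R) (E : 'I_k -> 'M[R]_n).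
Hypothesis ZE : spectral_resolution Z d E.

Lemma sr_mulE (a : 'I_k -> R) j : (\sum_i a i *: E i) *m E j = a j *: E j.
Proof.
rewrite mulmx_suml (bigD1 j) //= big1 => [|i ij].
  by rewrite -scalemxAl (sr_idem ZE) addr0.
by rewrite -scalemxAl (sr_orth ZE) // scaler0.
Qed.

Lemma sr_mul (a b : 'I_k -> R) :
  (\sum_i a i *: E i) *m (\sum_i b i *: E i) = \sum_i (a i * b i) *: E i.
Proof.
rewrite mulmx_sumr; apply: eq_bigr => j _.
by rewrite -scalemxAr sr_mulE scalerA mulrC.
Qed.

Lemma sr_sum_sym (a : 'I_k -> R) : sym (\sum_i a i *: E i).
Proof. by apply: sym_sum => i _; apply/symZ/(sr_sym ZE). Qed.

Lemma sr_psdE i : psd (E i).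
Proof. by apply: psd_idem; [exact: (sr_sym ZE) | exact: (sr_idem ZE)]. Qed.

Lemma sr_psd (a : 'I_k -> R) : (forall i, 0 <= a i) -> psd (\sum_i a i *: E i).
Proof. by move=> a0; apply: psd_sum => i _; apply/psdZ/sr_psdE. Qed.

Lemma sr_ip (X : 'M[R]_n) : ip Z X = \sum_i d i * \tr (E i *m X *m E i).
Proof.
rewrite {1}(sr_eq ZE) /ip mulmx_suml raddf_sum /=; apply: eq_bigr => i _.
rewrite -scalemxAl mxtraceZ; congr (_ * _).
by rewrite [RHS]mxtrace_mulC mulmxA (sr_idem ZE).
Qed.

Lemma sr_const c : c%:M = \sum_i c *: E i.
Proof. by rewrite -scaler_sumr (sr_one ZE) scalemx1. Qed.

End Resolution.

(** * Projection onto the PSD cone *)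

Section Projection.
Variables (R : realType) (n : nat).
Implicit Types (X Y Z B : 'M[R]_n).

Lemma psd_ip_ge0 X Y : psd X -> psd Y -> 0 <= ip X Y.
Proof.
move=> pX pY; have [k [d [E XE]]] := spectral_resolution_exists (proj1 pX).
rewrite (sr_ip XE); apply: sumr_ge0 => i _.
have sE := sr_sym XE i.
(* A zero projector says nothing about the sign of [d i]; otherwise compressing [X] by [E i] forces
   [d i] to be nonnegative. *)
have [E0|EN0] := eqVneq (E i) 0; first by rewrite E0 mulmx0 mxtrace0 mulr0.
apply: mulr_ge0; last exact/psd_trace_ge0/psd_conj_sym.
have: 0 <= \tr (E i *m X *m E i) by exact/psd_trace_ge0/psd_conj_sym.
have -> : E i *m X *m E i = d i *: ((E i)^T *m E i).
  by rewrite {1}(sr_eq XE) -mulmxA (sr_mulE XE) -scalemxAr sE.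
rewrite mxtraceZ; apply: contraLR; rewrite -!ltNge => di0.
rewrite nmulr_rlt0 // lt_neqAle sqnorm_ge0 andbT eq_sym.
by apply: contraNneq EN0 => e0; apply/eqP/sqnorm_eq0; rewrite /sqnorm e0.
Qed.

(** For PSD [U], the squared distance from [X - Y] to [U] is |X - U|^2 + 2<U,Y> + |Y|^2. As <U,Y> is
    nonnegative, [X] is a minimizer, and equality forces U = X, which determines the choice made by
    [xget]. The NSD half is symmetric. *)
Lemma moreau_unique X Y : psd X -> psd Y -> ip X Y = 0 ->
  PiP (X - Y) = X /\ PiN (X - Y) = - Y.
Proof.
move=> pX pY XY0; have [[sX _] [sY _]] := (pX, pY).
split; rewrite /PiP /PiN /proj.
  apply: xget_unique.
    split=> // U pU; have sU := proj1 pU.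
    have -> : X - Y - X = - Y by mx_ring.
    have -> : X - Y - U = (X - U) - Y by mx_ring.
    rewrite sqnormN (sqnormB (symB sX sU) sY) !ipE XY0.
    have := psd_ip_ge0 pU pY; have := sqnorm_ge0 (X - U); lra.
  move=> U [pU Umin]; have sU := proj1 pU; apply/eqP; rewrite -subr_eq0; apply/eqP.
  apply: sqnorm_eq0; have := Umin X pX.
  have -> : X - Y - X = - Y by mx_ring.
  have -> : X - Y - U = (X - U) - Y by mx_ring.
  rewrite sqnormN (sqnormB (symB sX sU) sY) !ipE XY0 -(sqnormN (U - X)) opprB.
  have := psd_ip_ge0 pU pY; have := sqnorm_ge0 (X - U); lra.
apply: xget_unique.
  split=> [|U pU]; first by rewrite /nsd opprK.
  have sU := proj1 pU; rewrite opprK subrK.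
  have -> : X - Y - U = X - (U + Y) by mx_ring.
  have sUY : sym (U + Y) by rewrite -[U]opprK; apply/symD/sY/symN.
  rewrite (sqnormB sX sUY) !ipE XY0.
  have := psd_ip_ge0 pX pU; rewrite ipE; have := sqnorm_ge0 (U + Y); lra.
move=> U [pU Umin]; have sU := proj1 pU.
apply/eqP; rewrite -subr_eq0 opprK; apply/eqP.
apply: sqnorm_eq0; have := Umin (- Y); rewrite /nsd !opprK subrK => /(_ pY).
have -> : X - Y - U = X - (U + Y) by mx_ring.
have sUY : sym (U + Y) by rewrite -[U]opprK; apply/symD/sY/symN.
rewrite (sqnormB sX sUY) !ipE XY0.
have := psd_ip_ge0 pX pU; rewrite ipE; have := sqnorm_ge0 (U + Y); lra.
Qed.

(** The factor [F], the spectral projector onto the nonnegative eigenvalues, records that the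
    positive part is a multiple of [Z] on both sides; [PiP_support] rests on it. *)
Lemma moreau_exists Z : sym Z -> exists X Y,
  [/\ psd X, psd Y, X *m Y = 0, Z = X - Y & exists F, X = Z *m F /\ X = F *m Z].
Proof.
move=> sZ; have [k [d [E ZE]]] := spectral_resolution_exists sZ.
exists (\sum_i Num.max (d i) 0 *: E i), (\sum_i Num.max (- d i) 0 *: E i); split.
- by apply: (sr_psd ZE) => i; rewrite le_max lexx orbT.
- by apply: (sr_psd ZE) => i; rewrite le_max lexx orbT.
- rewrite (sr_mul ZE) big1 // => i _; case: (lerP 0 (d i)) => di.
    by rewrite (max_r (_ : - d i <= 0)) ?mulr0 ?scale0r // oppr_le0.
  by rewrite mul0r scale0r.
- rewrite [LHS](sr_eq ZE) -sumrB; apply: eq_bigr => i _; rewrite -scalerBl.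
  congr (_ *: _); case: (lerP 0 (d i)) => di.
    by rewrite max_r ?subr0 // oppr_le0.
  by rewrite max_l ?opprK ?add0r // oppr_ge0 ltW.
exists (\sum_i (0 <= d i :> R)%R%:R *: E i); rewrite {1 2}(sr_eq ZE) !(sr_mul ZE).
split; apply: eq_bigr => i _; congr (_ *: _);
  by case: lerP; rewrite ?mul1r ?mulr1 ?mul0r ?mulr0.
Qed.

Lemma PiP_spec Z : sym Z ->
  [/\ psd (PiP Z), psd (PiP Z - Z), PiP Z *m (PiP Z - Z) = 0,
      PiN Z = Z - PiP Z & exists F, PiP Z = Z *m F /\ PiP Z = F *m Z].
Proof.
move=> sZ; have [X [Y [pX pY XY0 ZXY hF]]] := moreau_exists sZ.
have [eP eN] := moreau_unique pX pY (etrans (congr1 mxtrace XY0) (mxtrace0 _ _)).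
have -> : PiP Z = X by rewrite {1}ZXY.
have XZ : X - Z = Y by rewrite ZXY; mx_ring.
by rewrite -[Z - X]opprB XZ; split=> //; rewrite {1}ZXY.
Qed.

Lemma PiP_psd Z : sym Z -> psd (PiP Z). Proof. by case/PiP_spec. Qed.

Lemma PiP_sym Z : sym Z -> sym (PiP Z). Proof. by case/PiP_psd. Qed.

Lemma PiNE Z : sym Z -> PiN Z = Z - PiP Z. Proof. by case/PiP_spec. Qed.

Lemma PiPN Z : sym Z -> PiP (- Z) = PiP Z - Z.
Proof.
case/PiP_spec => pP pN P0 _ _.
have P0' : ip (PiP Z - Z) (PiP Z) = 0 by rewrite ipC /ip P0 mxtrace0.
have [<- _] := moreau_unique pN pP P0'; congr PiP; mx_ring.
Qed.

Lemma PiP_mulN Z : sym Z -> PiP Z *m PiP (- Z) = 0.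
Proof. by move=> sZ; rewrite PiPN //; case/PiP_spec: sZ. Qed.

Lemma PiP_support B E : sym B -> E *m B = B -> B *m E = B ->
  E *m PiP B = PiP B /\ PiP B *m E = PiP B.
Proof.
case/PiP_spec => _ _ _ _ [F [BF FB]] EB BE.
by split; [rewrite BF mulmxA EB | rewrite FB -mulmxA BE].
Qed.

Lemma PiP_firm Z1 Z2 : sym Z1 -> sym Z2 ->
  0 <= ip (PiP Z1 - PiP Z2) ((Z1 - Z2) - (PiP Z1 - PiP Z2)).
Proof.
case/PiP_spec => p1 q1 o1 _ _ /PiP_spec[p2 q2 o2 _ _].
have -> : Z1 - Z2 - (PiP Z1 - PiP Z2) = (PiP Z2 - Z2) - (PiP Z1 - Z1).
  mx_ring.
have e1 : ip (PiP Z1) (PiP Z1 - Z1) = 0 by rewrite /ip o1 mxtrace0.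
have e2 : ip (PiP Z2) (PiP Z2 - Z2) = 0 by rewrite /ip o2 mxtrace0.
have := psd_ip_ge0 p1 q2; have := psd_ip_ge0 p2 q1.
move: (PiP Z1 - Z1) (PiP Z2 - Z2) e1 e2 => a b e1 e2.
by rewrite !ipE e1 e2; lra.
Qed.

(** Write Z = P - Q by Moreau and expand the square of (Q - Y) - (P - X): the terms <X,Q>, <P,Y> and
    |Q - Y|^2 are nonnegative and may be dropped. *)
Lemma PiP_approx X Y Z : psd X -> psd Y -> sym Z ->
  sqnorm (PiP Z - X) <= 2 * ip X Y + sqnorm (X - Y - Z).
Proof.
move=> pX pY sZ; have [p q o _ _] := PiP_spec sZ.
have sP := proj1 p; have [sX _] := pX; have [sY _] := pY.
have e0 : ip (PiP Z) (PiP Z - Z) = 0 by rewrite /ip o mxtrace0.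
have eZ : Z = PiP Z - (PiP Z - Z) by mx_ring.
have sQ : sym (PiP Z - Z) by exact: symB.
rewrite {2}eZ.
move: (PiP Z - Z) q e0 sQ {o eZ} => Q q e0 sQ.
have -> : X - Y - (PiP Z - Q) = (Q - Y) - (PiP Z - X).
  mx_ring.
rewrite (sqnormB (symB sQ sY) (symB sP sX)).
have := psd_ip_ge0 pX q; have := psd_ip_ge0 p pY; have := sqnorm_ge0 (Q - Y).
rewrite !ipE (ipC Q (PiP Z)) e0 (ipC Y (PiP Z)) (ipC Y X) (ipC Q X).
by lra.
Qed.

Lemma sym_bounded Z : sym Z ->
  exists c, [/\ 0 <= c, psd (c%:M + Z) & psd (c%:M - Z)].
Proof.
move=> sZ; have [k [d [E ZE]]] := spectral_resolution_exists sZ.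
exists (\sum_i `|d i|); rewrite (sr_const ZE) {1 2}(sr_eq ZE) -sumrB -big_split /=.
have le_d i : `|d i| <= \sum_j `|d j|.
  by rewrite (bigD1 i) //= lerDl sumr_ge0.
split; first exact: sumr_ge0.
  rewrite (eq_bigr (fun i => (\sum_j `|d j| + d i) *: E i)) => [|i _].
    apply: (sr_psd ZE) => i; have := le_d i; have := lerNnormlW (lexx `|d i|); lra.
  by rewrite scalerDl.
rewrite (eq_bigr (fun i => (\sum_j `|d j| - d i) *: E i)) => [|i _].
  apply: (sr_psd ZE) => i; have := le_d i; have := ler_norm (d i); lra.
by rewrite scalerBl.
Qed.

End Projection.

(** * Matrix expansions at 0+ *)

Section Asymptotics.
Variables (R : realType) (n : nat).
Implicit Types (f g h : R -> 'M[R]_n) (X Y Z M : 'M[R]_n).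

Definition isO (k : nat) f := exists2 c : R, 0 <= c &
  \forall t \near 0^'+, forall i j, `|f t i j| <= c * t ^+ k.

Lemma isO_near_eq k f g :
  (\forall t \near 0^'+, f t = g t) -> isO k f -> isO k g.
Proof.
move=> fg [c c0 fc]; exists c => //; near=> t => i j.
have <- : f t = g t by near: t.
by move: i j; near: t.
Unshelve. all: by end_near. Qed.

Lemma isO_eq k f g : (forall t, f t = g t) -> isO k f -> isO k g.
Proof. by move=> fg; apply: isO_near_eq; apply: nearW. Qed.

Lemma isOD k f g : isO k f -> isO k g -> isO k (fun t => f t + g t).
Proof.
move=> [c c0 fc] [d d0 gd]; exists (c + d); first exact: addr_ge0.
near=> t => i j; rewrite mxE mulrDl; apply: le_trans (ler_normD _ _) _.
by apply: lerD; move: i j; near: t.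
Unshelve. all: by end_near. Qed.

Lemma isON k f : isO k f -> isO k (fun t => - f t).
Proof.
move=> [c c0 fc]; exists c => //; near=> t => i j; rewrite mxE normrN.
by move: i j; near: t.
Unshelve. all: by end_near. Qed.

Lemma isO_tr k f : isO k f -> isO k (fun t => (f t)^T).
Proof.
move=> [c c0 fc]; exists c => //; near=> t => i j; rewrite mxE.
by move: j i; near: t.
Unshelve. all: by end_near. Qed.

Lemma isOM k l f g : isO k f -> isO l g -> isO (k + l) (fun t => f t *m g t).
Proof.
move=> [c c0 fc] [d d0 gd]; exists (n%:R * (c * d)).
  by rewrite mulr_ge0 ?mulr_ge0.
near=> t => i j; have t0 : 0 < t by near: t; exact: nbhs_right_gt.
have fct : forall i j, `|f t i j| <= c * t ^+ k by near: t.
have gdt : forall i j, `|g t i j| <= d * t ^+ l by near: t.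
rewrite mxE; apply: le_trans (ler_norm_sum _ _ _) _.
have -> : n%:R * (c * d) * t ^+ (k + l) =
    \sum_(p < n) (c * t ^+ k) * (d * t ^+ l).
  by rewrite sumr_const card_ord -[RHS]mulr_natl exprD; ring.
by apply: ler_sum => p _; rewrite normrM ler_pM.
Unshelve. all: by end_near. Qed.

Lemma isOW k l f : (k <= l)%N -> isO l f -> isO k f.
Proof.
move=> kl [c c0 fc]; exists c => //; near=> t => i j.
have t0 : 0 < t by near: t; exact: nbhs_right_gt.
have t1 : t < 1 by near: t; exact: nbhs_right_lt.
apply: (@le_trans _ _ (c * t ^+ l)); first by move: i j; near: t.
by rewrite ler_wpM2l // ler_wiXn2l // ltW.
Unshelve. all: by end_near. Qed.

Lemma isO_cst M : isO 0 (fun=> M).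
Proof.
exists (\sum_i \sum_j `|M i j|); first by do 2!apply: sumr_ge0 => ? _.
near=> t => i j; rewrite expr0 mulr1 (bigD1 i) //= (bigD1 j) //= -addrA lerDl.
by rewrite addr_ge0 // ?sumr_ge0 // => ? _; apply: sumr_ge0.
Unshelve. all: by end_near. Qed.

Lemma isOZ k l f : isO l f -> isO (k + l) (fun t => t ^+ k *: f t).
Proof.
move=> [c c0 fc]; exists c => //; near=> t => i j.
have t0 : 0 < t by near: t; exact: nbhs_right_gt.
rewrite mxE normrM ger0_norm ?exprn_ge0 ?(ltW t0) // exprD mulrCA.
rewrite ler_wpM2l ?exprn_ge0 ?(ltW t0) //.
by move: i j; near: t.
Unshelve. all: by end_near. Qed.

Lemma isOZV k l f : isO (k + l) f -> isO l (fun t => (t ^+ k)^-1 *: f t).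
Proof.
move=> [c c0 fc]; exists c => //; near=> t => i j.
have t0 : 0 < t by near: t; exact: nbhs_right_gt.
rewrite mxE normrM ger0_norm ?invr_ge0 ?exprn_ge0 ?(ltW t0) //.
rewrite mulrC ler_pdivrMr ?exprn_gt0 // -mulrA (mulrC (t ^+ l)) -exprD.
by move: i j; near: t.
Unshelve. all: by end_near. Qed.

Lemma isO_scale a k f : isO k f -> isO k (fun t => a *: f t).
Proof.
move=> fk; have := isOM (isO_cst a%:M) fk; apply: isO_eq => t.
by rewrite mul_scalar_mx.
Qed.

Lemma isO_sqnorm k f : isO k f <->
  exists2 c : R, 0 <= c & \forall t \near 0^'+, sqnorm (f t) <= c * t ^+ (k + k).
Proof.
split=> [[c c0 fc]|[c c0 fc]].
  exists (n%:R * n%:R * (c * c)); first by rewrite !mulr_ge0.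
  near=> t; have t0 : 0 < t by near: t; exact: nbhs_right_gt.
  have fct : forall i j, `|f t i j| <= c * t ^+ k by near: t.
  have -> : n%:R * n%:R * (c * c) * t ^+ (k + k) =
      \sum_(i < n) \sum_(j < n) (c * t ^+ k) ^+ 2.
    by rewrite !sumr_const card_ord -mulrnA -[RHS]mulr_natl natrM exprD; ring.
  rewrite sqnorm_sum; do 2!apply: ler_sum => ? _.
  by rewrite -real_normK ?num_real // ler_pXn2r ?nnegrE // mulr_ge0 // exprn_ge0 ?ltW.
(* [c + 1] stands in for a square root of [c], since c <= (c + 1)^2. *)
exists (c + 1); first exact: addr_ge0.
near=> t => i j; have t0 : 0 < t by near: t; exact: nbhs_right_gt.
have ct0 : 0 <= (c + 1) * t ^+ k by rewrite mulr_ge0 ?addr_ge0 // exprn_ge0 ?ltW.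
rewrite -(@ler_pXn2r _ 2) ?nnegrE // real_normK ?num_real //.
apply: le_trans (entry_sqnorm _ _ _) _; apply: (@le_trans _ _ (c * t ^+ (k + k))).
  by near: t.
rewrite exprMn -exprM mulnC mul2n addnn ler_wpM2r ?exprn_ge0 ?(ltW t0) //.
by rewrite expr2; nra.
Unshelve. all: by end_near. Qed.

Lemma isO_trace k f : isO k f ->
  exists2 c : R, 0 <= c & \forall t \near 0^'+, `|\tr (f t)| <= c * t ^+ k.
Proof.
move=> [c c0 fc]; exists (n%:R * c); first by rewrite mulr_ge0.
near=> t; have fct : forall i j, `|f t i j| <= c * t ^+ k by near: t.
apply: le_trans (ler_norm_sum _ _ _) _.
have -> : n%:R * c * t ^+ k = \sum_(p < n) (c * t ^+ k).
  by rewrite sumr_const card_ord -[RHS]mulr_natl; ring.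
exact: ler_sum.
Unshelve. all: by end_near. Qed.

Lemma isO_trace_ge0 f M : isO 1 (fun t => f t - M) ->
  (\forall t \near 0^'+, 0 <= \tr (f t)) -> 0 <= \tr M.
Proof.
move=> /isO_trace[c c0 fc] f0; rewrite leNgt; apply/negP => M0.
have e0 : 0 < - \tr M / (c + 1) by rewrite divr_gt0 ?oppr_gt0 // ltr_wpDl.
have : \forall t \near (0 : R)^'+, False.
  near=> t; have t0 : 0 < t by near: t; exact: nbhs_right_gt.
  have te : t < - \tr M / (c + 1) by near: t; exact: nbhs_right_lt.
  have ft : 0 <= \tr (f t) by near: t.
  have : `|\tr (f t - M)| <= c * t ^+ 1 by near: t.
  rewrite expr1 raddfB /= => h1; have := le_trans (ler_norm _) h1.
  move: te; rewrite ltr_pdivlMr ?ltr_wpDl //; nra.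
by move/filter_ex => [].
Unshelve. all: by end_near. Qed.

Definition congO k f g := isO k (fun t => f t - g t).

Lemma congO_isO k l f g : (l <= k)%N -> congO k f g -> isO l g -> isO l f.
Proof.
move=> lk fg gl; apply: isO_eq (isOD (isOW lk fg) gl) => t.
by rewrite subrK.
Qed.

Lemma congO_trans k f g h : congO k f g -> congO k g h -> congO k f h.
Proof. by move=> fg gh; apply: isO_eq (isOD fg gh) => t; mx_ring. Qed.

Lemma congO_near k f g : (\forall t \near 0^'+, f t = g t) -> congO k f g.
Proof.
move=> fg; exists 0 => //; near=> t => i j.
by rewrite (_ : f t = g t) ?subrr ?mxE ?normr0 ?mul0r //; near: t.
Unshelve. all: by end_near. Qed.

Lemma congO_refl k f g : (forall t, f t = g t) -> congO k f g.
Proof. by move=> fg; apply: congO_near; apply: nearW. Qed.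

Lemma congOD k f g f' g' : congO k f f' -> congO k g g' ->
  congO k (fun t => f t + g t) (fun t => f' t + g' t).
Proof. by move=> ff gg; apply: isO_eq (isOD ff gg) => t; mx_ring. Qed.

Lemma congON k f f' : congO k f f' -> congO k (fun t => - f t) (fun t => - f' t).
Proof. by move=> ff; apply: isO_eq (isON ff) => t; mx_ring. Qed.

Lemma congO_tr k f f' : congO k f f' -> congO k (fun t => (f t)^T) (fun t => (f' t)^T).
Proof. by move=> ff; apply: isO_eq (isO_tr ff) => t; rewrite linearB. Qed.

Lemma congOM k f g f' g' : isO 0 f' -> isO 0 g' -> congO k f f' -> congO k g g' ->
  congO k (fun t => f t *m g t) (fun t => f' t *m g' t).
Proof.
move=> bf' bg' ff gg; have bf := congO_isO (leq0n k) ff bf'.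
have fb := isOM ff bg'; rewrite addn0 in fb.
apply: isO_eq (isOD (isOM bf gg) fb) => t.
by rewrite mulmxBr mulmxBl addrA subrK.
Qed.

Definition jet1 f X0 X1 := congO 2 f (fun t => X0 + t *: X1).
(** [X2] is the coefficient of [t ^+ 2], half of a second derivative; hence the factors [2^-1]
    below. *)
Definition jet2 f X0 X1 X2 := congO 3 f (fun t => X0 + t *: X1 + t ^+ 2 *: X2).

Lemma isO_poly2 X0 X1 X2 : isO 0 (fun t => X0 + t *: X1 + t ^+ 2 *: X2).
Proof.
apply: isOD; first apply: isOD; first exact: isO_cst.
  by apply: isOW (isOZ 1 (isO_cst X1)).
by apply: isOW (isOZ 2 (isO_cst X2)).
Qed.

Lemma jet2D f g X0 X1 X2 Y0 Y1 Y2 : jet2 f X0 X1 X2 -> jet2 g Y0 Y1 Y2 ->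
  jet2 (fun t => f t + g t) (X0 + Y0) (X1 + Y1) (X2 + Y2).
Proof.
by move=> ff gg; apply: congO_trans (congOD ff gg) _; apply: congO_refl => t; mx_ring.
Qed.

Lemma jet2N f X0 X1 X2 : jet2 f X0 X1 X2 ->
  jet2 (fun t => - f t) (- X0) (- X1) (- X2).
Proof.
by move=> ff; apply: congO_trans (congON ff) _; apply: congO_refl => t; mx_ring.
Qed.

Lemma jet2_tr f X0 X1 X2 : jet2 f X0 X1 X2 ->
  jet2 (fun t => (f t)^T) X0^T X1^T X2^T.
Proof.
by move=> ff; apply: congO_trans (congO_tr ff) _; apply: congO_refl => t; mx_ring.
Qed.

Lemma jet2M f g X0 X1 X2 Y0 Y1 Y2 : jet2 f X0 X1 X2 -> jet2 g Y0 Y1 Y2 ->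
  jet2 (fun t => f t *m g t) (X0 *m Y0) (X0 *m Y1 + X1 *m Y0)
    (X0 *m Y2 + X1 *m Y1 + X2 *m Y0).
Proof.
move=> ff gg; apply: congO_trans (congOM (isO_poly2 _ _ _) (isO_poly2 _ _ _) ff gg) _.
have b3 := isOZ 3 (isO_cst (X1 *m Y2 + X2 *m Y1)).
have b4 := isOW (isT : 3 <= 4)%N (isOZ 4 (isO_cst (X2 *m Y2))).
apply: isO_eq (isOD b3 b4) => t.
rewrite !(mulmxDl, mulmxDr) -!(scalemxAl, scalemxAr).
move: (X0 *m Y0) (X0 *m Y1) (X0 *m Y2) (X1 *m Y0) (X1 *m Y1) (X1 *m Y2).
move: (X2 *m Y0) (X2 *m Y1) (X2 *m Y2) => *.
mx_ring.
Qed.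

Lemma jet2_poly X0 X1 X2 : jet2 (fun t => X0 + t *: X1 + t ^+ 2 *: X2) X0 X1 X2.
Proof. exact: congO_refl. Qed.

(** Serves the kernel block: PiP (t B + t^2 G) = t PiP (B + t G), so a first-order expansion of the
    projection there already yields order two. *)
Lemma jet2_scale f X0 X1 : jet1 f X0 X1 -> jet2 (fun t => t *: f t) 0 X0 X1.
Proof.
move=> ff; apply: isO_eq (isOZ 1 ff) => t; rewrite expr1; mx_ring.
Qed.

Lemma jet2_eq f g X0 X1 X2 Y0 Y1 Y2 : (forall t, f t = g t) ->
  X0 = Y0 -> X1 = Y1 -> X2 = Y2 -> jet2 f X0 X1 X2 -> jet2 g Y0 Y1 Y2.
Proof.
by move=> fg -> -> ->; apply: isO_eq => t; rewrite fg.
Qed.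

(* The terms of order two may be discarded, so first-order expansions follow
   from the calculus of second-order ones. *)
Lemma jet21 f X0 X1 X2 : jet2 f X0 X1 X2 -> jet1 f X0 X1.
Proof.
move=> ff; have b2 := isOZ 2 (isO_cst X2).
apply: isO_eq (isOD (isOW (isT : 2 <= 3)%N ff) b2) => t; mx_ring.
Qed.

Lemma jet1_linear X0 X1 : jet1 (fun t => X0 + t *: X1) X0 X1.
Proof. exact: congO_refl. Qed.

Lemma isO_cvg f M : isO 1 (fun t => f t - M) -> f t @[t --> 0^'+] --> M.
Proof.
move=> [c c0 fc]; apply/cvgrPdist_le => e e0; near=> t.
have t0 : 0 < t by near: t; exact: nbhs_right_gt.
have te : t < e / (c + 1) by near: t; apply: nbhs_right_lt; rewrite divr_gt0 // ltr_wpDl.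
have fct : forall i j, `|(f t - M) i j| <= c * t ^+ 1 by near: t.
rewrite distrC [leLHS]/Num.norm /= mx_normrE; apply: bigmax_le => [|[i j] _]; first exact: ltW.
apply: le_trans (fct i j) _; move: te; rewrite ltr_pdivlMr ?ltr_wpDl // expr1; nra.
Unshelve. all: by end_near. Qed.

Lemma dd_jet1 (F : 'M[R]_n -> 'M[R]_n) Z H L :
  jet1 (fun t => F (Z + t *: H)) (F Z) L -> dd F Z H = L.
Proof.
move=> FL; rewrite /dd; apply: cvg_lim => //; apply: isO_cvg.
apply: isO_near_eq (isOZV (k := 1) (l := 1) FL); near=> t.
have t0 : t != 0 by rewrite gt_eqF //; near: t; exact: nbhs_right_gt.
by rewrite expr1 opprD addrA scalerDr scalerN scalerA mulVf // scale1r.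
Unshelve. all: by end_near. Qed.

Lemma dd2_jet2 (F : 'M[R]_n -> 'M[R]_n) Z H W L :
  jet2 (fun t => F (Z + t *: H + (t ^+ 2 / 2) *: W)) (F Z) (dd F Z H) (2^-1 *: L) ->
  dd2 F Z H W = L.
Proof.
move=> FL; rewrite /dd2; apply: cvg_lim => //; apply: isO_cvg.
apply: isO_near_eq (isO_scale 2 (isOZV (k := 2) (l := 1) FL)); near=> t.
have t0 : t != 0 by rewrite gt_eqF //; near: t; exact: nbhs_right_gt.
move: (F _) (F _) (dd _ _ _) => A B D.
by apply/matrixP => i j; rewrite !mxE; field.
Unshelve. all: by end_near. Qed.

End Asymptotics.

(** * Asymptotic stability of the Moreau decomposition *)

Section Approximation.
Variables (R : realType) (n : nat).
Implicit Types (f g h : R -> 'M[R]_n) (X Y Z M : 'M[R]_n).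

Lemma PiP_congO k (X Y Z : R -> 'M[R]_n) :
  (\forall t \near 0^'+, [/\ psd (X t), psd (Y t) & sym (Z t)]) ->
  (exists2 c, 0 <= c & \forall t \near 0^'+, ip (X t) (Y t) <= c * t ^+ (k + k)) ->
  congO k (fun t => X t - Y t) Z -> congO k (fun t => PiP (Z t)) X.
Proof.
move=> XYZ [c c0 XY] /isO_sqnorm[d d0 Zd]; apply/isO_sqnorm.
exists (2 * c + d); first by rewrite addr_ge0 ?mulr_ge0.
near=> t; have [pX pY sZ] : [/\ psd (X t), psd (Y t) & sym (Z t)] by near: t.
apply: le_trans (PiP_approx pX pY sZ) _; rewrite [leRHS]mulrDl -mulrA.
apply: lerD; last by near: t.
by rewrite ler_wpM2l //; near: t.
Unshelve. all: by end_near. Qed.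

(* With U^T U = 1 + O(t^k), the congruence by U preserves orthogonality of X
   and Y up to O(t^2k), which is negligible at the level of PiP_approx. *)
Lemma PiP_congr_congO k (U X Y Z : R -> 'M[R]_n) :
  (\forall t \near 0^'+, [/\ psd (X t), psd (Y t), X t *m Y t = 0 & sym (Z t)]) ->
  isO 0 X -> isO 0 Y -> congO k (fun t => (U t)^T *m U t) (fun=> 1%:M) ->
  congO k (fun t => U t *m (X t - Y t) *m (U t)^T) Z ->
  congO k (fun t => PiP (Z t)) (fun t => U t *m X t *m (U t)^T).
Proof.
move=> XYZ bX bY bU UZ.
apply: (@PiP_congO k _ (fun t => U t *m Y t *m (U t)^T)).
- near=> t; have [pX pY _ sZ] : [/\ psd (X t), psd (Y t), X t *m Y t = 0 & sym (Z t)]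
    by near: t.
  by split=> //; apply: psd_conj.
- have := isOM (isOM bX bU) (isOM bY bU); rewrite !add0n => /isO_trace[c c0 bc].
  exists c => //; near=> t.
  have [[sX _] [sY _] XY _] :
    [/\ psd (X t), psd (Y t), X t *m Y t = 0 & sym (Z t)] by near: t.
  have YX : Y t *m X t = 0 by rewrite -sX -sY -trmx_mul XY trmx0.
  have h : `|\tr (X t *m ((U t)^T *m U t - 1%:M) *m
      (Y t *m ((U t)^T *m U t - 1%:M)))| <= c * t ^+ (k + k) by near: t.
  apply: (le_trans _ h); apply: (le_trans _ (ler_norm _)).
  rewrite le_eqVlt; apply/orP; left; apply/eqP.
  set E := _ - _; have NE : (U t)^T *m U t = 1%:M + E by rewrite /E addrC subrK.
  have -> : ip (U t *m X t *m (U t)^T) (U t *m Y t *m (U t)^T) =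
      \tr (X t *m ((U t)^T *m U t) *m (Y t *m ((U t)^T *m U t))).
    by rewrite /ip -!mulmxA mxtrace_mulC !mulmxA.
  rewrite NE; move: E {NE} => E.
  (* Only tr (X E Y E) survives: every other term contains [X Y], or [Y X] after a cyclic
     permutation. *)
  rewrite !mulmxDr !mulmx1 !mulmxDl !XY !mxtraceD mulmxA XY mul0mx !mxtrace0.
  by rewrite (mxtrace_mulC _ (Y t)) (mulmxA (Y t)) YX mul0mx mxtrace0 !add0r.
by apply: isO_eq UZ => t; rewrite mulmxBr mulmxBl.
Unshelve. all: by end_near. Qed.

End Approximation.

(** * Derivatives of the projection *)

(* Spectral splitting of Z by the sign of its eigenvalues; [S] solves the
   Sylvester equation [S G * Z - Z * S G = G] off the diagonal blocks. *)
Record sign_split (R : realType) (n : nat) (Z Ea Eb Ec Zd : 'M[R]_n)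
    (S : 'M[R]_n -> 'M[R]_n) : Prop := SignSplit {
  ss_sa : sym Ea; ss_sb : sym Eb; ss_sc : sym Ec;
  ss_aa : Ea *m Ea = Ea; ss_bb : Eb *m Eb = Eb; ss_cc : Ec *m Ec = Ec;
  ss_ab : Ea *m Eb = 0; ss_ac : Ea *m Ec = 0; ss_bc : Eb *m Ec = 0;
  ss_one : Ea + Eb + Ec = 1%:M;
  ss_aZ : Ea *m Z = Z *m Ea; ss_cZ : Ec *m Z = Z *m Ec; ss_bZ : Eb *m Z = 0;
  ss_gap : exists2 c : R, 0 < c &
    psd (Ea *m Z - c *: Ea) /\ psd (- (Ec *m Z) - c *: Ec);
  ss_skew : forall G, sym G -> (S G)^T = - S G;
  ss_add : forall G G', S (G + G') = S G + S G';
  ss_scale : forall a G, S (a *: G) = a *: S G;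
  ss_syl : forall G, S G *m Z - Z *m S G =
    G - (Ea *m G *m Ea + Eb *m G *m Eb + Ec *m G *m Ec);
  ss_Sbb : forall G, Eb *m S G *m Eb = 0;
  ss_sZd : sym Zd; ss_ZZd : Z *m Zd = Ea + Ec; ss_ZdZ : Zd *m Z = Ea + Ec;
  ss_bZd : Eb *m Zd = 0; ss_Zdb : Zd *m Eb = 0 }.

Section SignSplitExists.
Variables (R : realType) (n k : nat) (Z : 'M[R]_n).
Variables (d : 'I_k -> R) (E : 'I_k -> 'M[R]_n).
Hypothesis ZE : spectral_resolution Z d E.

Let ch (p : pred R) := \sum_i (p (d i))%:R *: E i.
(** Passing from S to S Z - Z S multiplies the (i, j) block by [d j - d i], so dividing by it solves
    the Sylvester equation. Pairs of equal sign, which make up the diagonal blocks, get 0. *)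
Let w i j : R := if Num.sg (d i) == Num.sg (d j) then 0 else (d j - d i)^-1.
Let S (G : 'M[R]_n) := \sum_i \sum_j w i j *: (E i *m G *m E j).

Lemma sr_sandwich (a b : 'I_k -> R) (G : 'M[R]_n) :
  (\sum_i a i *: E i) *m G *m (\sum_j b j *: E j) =
  \sum_i \sum_j (a i * b j) *: (E i *m G *m E j).
Proof.
rewrite !mulmx_suml; apply: eq_bigr => i _; rewrite mulmx_sumr.
by apply: eq_bigr => j _; rewrite -!scalemxAl -scalemxAr scalerA.
Qed.

Lemma sr_block_mul (a b : 'I_k -> R) (x : 'I_k -> 'I_k -> R) (G : 'M[R]_n) :
  (\sum_i a i *: E i) *m (\sum_i \sum_j x i j *: (E i *m G *m E j))
    *m (\sum_j b j *: E j) =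
  \sum_i \sum_j (a i * x i j * b j) *: (E i *m G *m E j).
Proof.
have := sr_mulE ZE a; have : forall j, E j *m (\sum_j b j *: E j) = b j *: E j.
  move=> j; rewrite mulmx_sumr (bigD1 j) //= big1 => [|l lj].
    by rewrite -scalemxAr (sr_idem ZE) addr0.
  by rewrite -scalemxAr (sr_orth ZE) 1?eq_sym // scaler0.
move: (\sum_i a i *: E i) (\sum_j b j *: E j) => A B EB AE.
rewrite mulmx_sumr mulmx_suml; apply: eq_bigr => i _.
rewrite mulmx_sumr mulmx_suml; apply: eq_bigr => j _.
rewrite -scalemxAr -scalemxAl !mulmxA AE -(mulmxA _ (E j)) EB -!scalemxAl -scalemxAr.
by rewrite !scalerA; congr (_ *: _); ring.
Qed.

(** [\sum_i (d i)^-1 *: E i] inverts [Z] off its kernel and vanishes on it, because the inverse of 0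
    is 0. The fact [sgE] matches the sign test in [w] with the pairs of indicators that occur in the
    diagonal blocks. *)
Lemma sign_split_resolution :
  sign_split Z (ch (fun x => 0 < x)) (ch (fun x => x == 0)) (ch (fun x => x < 0))
    (\sum_i (d i)^-1 *: E i) S.
Proof.
have sgE x y : (Num.sg x == Num.sg y :> R) =
    (0 < x) && (0 < y) || (x == 0) && (y == 0) || (x < 0) && (y < 0).
  have e1 : (-1 == 1 :> R) = false by rewrite lt_eqF // (lt_trans (ltrN10 R)).
  have e2 : (0 == -1 :> R) = false by rewrite gt_eqF // ltrN10.
  have e3 : (-1 == 0 :> R) = false by rewrite lt_eqF // ltrN10.
  have e4 : (1 == 0 :> R) = false by rewrite oner_eq0.
  have e5 : (0 == 1 :> R) = false by rewrite eq_sym.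
  have e6 : (1 == -1 :> R) = false by rewrite eq_sym.
  by case: (ltrgt0P x) => [x0|x0|->]; case: (ltrgt0P y) => [y0|y0|->];
    rewrite ?(gtr0_sg x0) ?(gtr0_sg y0) ?(ltr0_sg x0) ?(ltr0_sg y0) ?sgr0
      ?e1 ?e2 ?e3 ?e4 ?e5 ?e6 ?eqxx.
have orth p q : (forall x, p x && q x = false) -> ch p *m ch q = 0.
  move=> pq; rewrite /ch (sr_mul ZE) big1 // => i _.
  by rewrite -natrM mulnb pq scale0r.
have idem p : ch p *m ch p = ch p.
  rewrite /ch (sr_mul ZE); apply: eq_bigr => i _.
  by rewrite -natrM mulnb andbb.
have one : ch (fun x => 0 < x) + ch (fun x => x == 0) + ch (fun x => x < 0) = 1%:M.
  rewrite /ch -!big_split -(sr_one ZE) /=; apply: eq_bigr => i _.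
  rewrite -!scalerDl -[RHS]scale1r; congr (_ *: _).
  by case: (ltrgt0P (d i)) => _; rewrite ?addr0 ?add0r.
have chZ p : ch p *m Z = Z *m ch p.
  rewrite (sr_eq ZE) /ch !(sr_mul ZE); apply: eq_bigr => i _.
  by rewrite mulrC.
have nz : \sum_i (d i * (d i)^-1) *: E i =
    ch (fun x => 0 < x) + ch (fun x => x < 0).
  rewrite /ch -big_split /=; apply: eq_bigr => i _; rewrite -scalerDl.
  congr (_ *: _); case: (ltrgt0P (d i)) => [d0|d0|->].
  - by rewrite mulfV ?gt_eqF // addr0.
  - by rewrite mulfV ?lt_eqF // add0r.
  - by rewrite mul0r addr0.
split; try exact: (sr_sum_sym ZE); try exact: idem; try exact: chZ.
- by apply: orth => x; case: ltrgt0P.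
- by apply: orth => x; case: ltrgt0P.
- by apply: orth => x; case: ltrgt0P.
- exact: one.
- rewrite (sr_eq ZE) /ch (sr_mul ZE) big1 // => i _.
  by case: eqP => [->|_]; rewrite ?mulr0 ?mul0r scale0r.
(* A lower bound for the nonzero |d i|, as each 1/|d i| is at most the sum; the added 1 keeps [c]
   positive when every [d i] is 0. *)
- pose c := (\sum_i `|d i|^-1 + 1)^-1.
  have s0 : 0 <= \sum_i `|d i|^-1 by apply: sumr_ge0 => i _; rewrite invr_ge0.
  have c0 : 0 < c by rewrite invr_gt0 ltr_wpDl.
  have cd i : d i != 0 -> c <= `|d i|.
    move=> di; rewrite -[leRHS]invrK lef_pV2 ?posrE ?ltr_wpDl ?invr_gt0 ?normr_gt0 //.
    rewrite (bigD1 i) //= -addrA lerDl addr_ge0 //.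
    by apply: sumr_ge0 => j _; rewrite invr_ge0.
  exists c => //; split.
    rewrite {1}(sr_eq ZE) /ch (sr_mul ZE) scaler_sumr -sumrB.
    rewrite (eq_bigr (fun i => ((0 < d i)%R%:R * (d i - c)) *: E i)); last first.
      by move=> i _; rewrite scalerA -scalerBl; congr (_ *: _); ring.
    apply: (sr_psd ZE) => i; case: (ltrP 0 (d i)) => di; rewrite ?mul0r // mul1r.
    by rewrite subr_ge0; have := cd i; rewrite gt_eqF // gtr0_norm //; apply.
  rewrite {1}(sr_eq ZE) /ch (sr_mul ZE) scaler_sumr -sumrN -sumrB.
  rewrite (eq_bigr (fun i => ((d i < 0)%R%:R * (- d i - c)) *: E i)); last first.
    by move=> i _; rewrite scalerA -scaleNr -scalerBl; congr (_ *: _); ring.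
  apply: (sr_psd ZE) => i; case: (ltrP (d i) 0) => di; rewrite ?mul0r // mul1r.
  by rewrite subr_ge0; have := cd i; rewrite lt_eqF // ltr0_norm //; apply.
- move=> G sG; rewrite /S [in RHS]exchange_big /= raddf_sum -sumrN.
  apply: eq_bigr => i _; rewrite raddf_sum -sumrN; apply: eq_bigr => j _.
  rewrite /= linearZ /= !trmx_mul !(sr_sym ZE) sG mulmxA -scaleNr; congr (_ *: _).
  by rewrite /w eq_sym; case: eqP; rewrite ?oppr0 // -invrN opprB.
- move=> G G'; rewrite /S -big_split; apply: eq_bigr => i _.
  rewrite -big_split; apply: eq_bigr => j _.
  by rewrite mulmxDr mulmxDl scalerDr.
- move=> a G; rewrite /S scaler_sumr; apply: eq_bigr => i _.
  rewrite scaler_sumr; apply: eq_bigr => j _.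
  by rewrite -scalemxAr -scalemxAl !scalerA mulrC.
- move=> G.
  have one1 : 1%:M = \sum_i 1 *: E i.
    by rewrite -(sr_one ZE); apply: eq_bigr => i _; rewrite scale1r.
  rewrite -[S G *m Z]mul1mx -[Z *m S G]mulmx1 -[X in _ = X - _]mul1mx.
  rewrite -[X in _ = X - _]mulmx1 mulmxA one1 {1 2}(sr_eq ZE) /S !sr_block_mul.
  rewrite /ch !sr_sandwich -!big_split -!sumrB; apply: eq_bigr => i _.
  rewrite -!big_split -!sumrB; apply: eq_bigr => j _ /=.
  rewrite -!scalerDl -!scalerBl; congr (_ *: _).
  rewrite -!natrM !mulnb /w sgE.
  case: ifPn; last first.
    rewrite !negb_or => /andP[/andP[/negPf h1 /negPf h2] /negPf h3].
    rewrite h1 h2 h3 /= !addr0 subr0 !mulr1 !mul1r (mulrC (d i)) -mulrBr mulVf //.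
    rewrite subr_eq0; apply/eqP => ji; move: h1 h2 h3; rewrite ji.
    by case: (ltrgt0P (d i)).
  rewrite !mulr0 !mul0r subrr => h; apply/esym/eqP; rewrite subr_eq0 mulr1.
  by move: h; case: (ltrgt0P (d i)) => _; case: (ltrgt0P (d j)) => _;
    rewrite //= ?addr0 ?add0r.
- move=> G; rewrite /S /ch sr_block_mul; apply: big1 => i _; apply: big1 => j _.
  rewrite /w sgE; case: (d i =P 0) => [->|_]; last by rewrite !mul0r scale0r.
  case: (d j =P 0) => [->|_]; last by rewrite mulr0 scale0r.
  by rewrite !orbT /= mulr0 mul0r scale0r.
- by rewrite {1}(sr_eq ZE) (sr_mul ZE).
- rewrite {1}(sr_eq ZE) (sr_mul ZE) -nz; apply: eq_bigr => i _.
  by rewrite mulrC.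
- rewrite /ch (sr_mul ZE) big1 // => i _.
  by case: eqP => [->|_]; rewrite ?invr0 ?mulr0 ?mul0r scale0r.
- rewrite /ch (sr_mul ZE) big1 // => i _.
  by case: eqP => [->|_]; rewrite ?invr0 ?mulr0 ?mul0r scale0r.
Qed.

End SignSplitExists.

Lemma sign_split_exists (R : realType) n (Z : 'M[R]_n) : sym Z ->
  exists Ea Eb Ec Zd S, sign_split Z Ea Eb Ec Zd S.
Proof.
move=> /spectral_resolution_exists[k [d [E ZE]]].
by do 5!eexists; apply: sign_split_resolution ZE.
Qed.

(** * First-order expansion of the projection *)

Section Expansion.
Variables (R : realType) (n : nat) (Z Ea Eb Ec Zd : 'M[R]_n).
Variable S : 'M[R]_n -> 'M[R]_n.
Hypotheses (sZ : sym Z) (ss : sign_split Z Ea Eb Ec Zd S).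
Implicit Types (H G W V : 'M[R]_n).

Lemma split_mulb : Z *m Eb = 0.
Proof. by rewrite -sZ -(ss_sb ss) -trmx_mul (ss_bZ ss) trmx0. Qed.

Definition block_diag G := Ea *m G *m Ea + Eb *m G *m Eb + Ec *m G *m Ec.

Lemma block_diag_sym G : sym G -> sym (block_diag G).
Proof.
by move=> sG; apply: symD; [apply: symD|]; apply: sym_conj_sym => //;
  [exact: ss_sa ss | exact: ss_sb ss | exact: ss_sc ss].
Qed.

Lemma block_diagD G G' : block_diag (G + G') = block_diag G + block_diag G'.
Proof. by rewrite /block_diag !mulmxDr !mulmxDl; mx_ring. Qed.

Lemma block_diagZ a G : block_diag (a *: G) = a *: block_diag G.
Proof. by rewrite /block_diag -!scalemxAr -!scalemxAl; mx_ring. Qed.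

Let ZE : Ea *m Z *m Ea + Ec *m Z *m Ec = Z.
Proof.
rewrite (ss_aZ ss) (ss_cZ ss) -!mulmxA (ss_aa ss) (ss_cc ss).
by rewrite -[RHS]mulmx1 -(ss_one ss) !mulmxDr split_mulb addr0.
Qed.

Lemma block_diag_id : block_diag Z = Z.
Proof. by rewrite /block_diag (ss_bZ ss) mul0mx addr0 ZE. Qed.

Lemma PiP_split : PiP Z = Ea *m Z.
Proof.
have [c c0 [pa pc]] := ss_gap ss.
have pEa : psd (Ea *m Z).
  rewrite -[_ *m _](subrK (c *: Ea)); apply: psdD => //.
  by apply/(psdZ (ltW c0))/psd_idem; [exact: ss_sa ss | exact: ss_aa ss].
have pEc : psd (- (Ec *m Z)).
  rewrite -[- _](subrK (c *: Ec)); apply: psdD => //.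
  by apply/(psdZ (ltW c0))/psd_idem; [exact: ss_sc ss | exact: ss_cc ss].
have [|<- _] := moreau_unique pEa pEc.
  rewrite ipNr /ip (ss_aZ ss) -mulmxA (mulmxA Ea) (ss_ac ss) mul0mx mulmx0.
  by rewrite mxtrace0 oppr0.
congr PiP; rewrite opprK -mulmxDl -[LHS]mul1mx -(ss_one ss) !mulmxDl.
by rewrite (ss_bZ ss) addr0.
Qed.

(** With [a] and [b] bounding [H] and [G], the perturbation is at least -(t a + t^2 b) E, which the
    gap [c] absorbs for small [t]. Hence only the kernel block, which has no gap, keeps a projection
    of its own. *)
Lemma near_psd_block (E D : 'M[R]_n) (c : R) H G : sym H -> sym G ->
  sym E -> E *m E = E -> 0 < c -> psd (D - c *: E) ->
  \forall t \near 0^'+, psd (D + E *m (t *: H + t ^+ 2 *: G) *m E).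
Proof.
move=> sH sG sE EE c0 pD.
have [a [a0 pH _]] := sym_bounded sH; have [b [b0 pG _]] := sym_bounded sG.
near=> t; have t0 : 0 < t by near: t; exact: nbhs_right_gt.
have t1 : t < 1 by near: t; exact: nbhs_right_lt.
have tc : t < c / (a + b + 1).
  by near: t; apply: nbhs_right_lt; rewrite divr_gt0 // ltr_wpDl ?addr_ge0.
have -> : D + E *m (t *: H + t ^+ 2 *: G) *m E =
    (D - c *: E) + t *: (E *m (a%:M + H) *m E) +
    t ^+ 2 *: (E *m (b%:M + G) *m E) + (c - t * a - t ^+ 2 * b) *: E.
  rewrite !mulmxDr !mulmxDl !mul_mx_scalar -!(scalemxAr, scalemxAl) EE.
  by move: (E *m H *m E) (E *m G *m E) => *; mx_ring.
apply: psdD; first apply: psdD; first apply: psdD => //.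
- by apply/(psdZ (ltW t0))/psd_conj_sym.
- by apply/psdZ/psd_conj_sym => //; rewrite exprn_ge0 // ltW.
apply: psdZ; last exact: psd_idem.
have ab : 0 < a + b + 1 by rewrite ltr_wpDl ?addr_ge0.
move: tc; rewrite ltr_pdivlMr // => tc.
have : t ^+ 2 * b <= t * b by rewrite expr2 ler_wpM2r // ler_piMl // ltW.
nra.
Unshelve. all: by end_near. Qed.

Lemma isO_PiP k (f : R -> 'M[R]_n) :
  (forall t, sym (f t)) -> isO k f -> isO k (fun t => PiP (f t)).
Proof.
move=> sf /isO_sqnorm[c c0 fc]; apply/isO_sqnorm; exists c => //.
near=> t; have := PiP_approx (psd0 R n) (psd0 R n) (sf t).
rewrite /ip mul0mx mxtrace0 mulr0 add0r !subr0 sub0r sqnormN => /le_trans; apply.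
by near: t.
Unshelve. all: by end_near. Qed.

(** In the diagonalized picture the positive part is the positive block plus the projected kernel
    block, and [Y] is the negative part built likewise. Distinct blocks annihilate each other, and
    so do [PiP (B t)] and [PiP (- B t)], so the product of the two parts is exactly 0, as
    [PiP_congr_congO] demands. *)
Lemma PiP_block_congO k (U Zt : R -> 'M[R]_n) H G : sym H -> sym G ->
  (forall t, sym (Zt t)) -> congO k (fun t => (U t)^T *m U t) (fun=> 1%:M) ->
  congO k (fun t => U t *m block_diag (Z + (t *: H + t ^+ 2 *: G)) *m (U t)^T) Zt ->
  congO k (fun t => PiP (Zt t)) (fun t => U t *m
    (Ea *m Z + Ea *m (t *: H + t ^+ 2 *: G) *m Ea
      + PiP (Eb *m (t *: H + t ^+ 2 *: G) *m Eb)) *m (U t)^T).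
Proof.
move=> sH sG sZt UU UZ.
pose M t := t *: H + t ^+ 2 *: G; pose B t := Eb *m M t *m Eb.
have sM t : sym (M t) by apply: symD; apply: symZ.
have sB t : sym (B t) by apply: sym_conj_sym => //; exact: ss_sb ss.
pose Y t := (- (Ec *m Z) + Ec *m (- M t) *m Ec) + PiP (- B t).
have [c c0 [pa pc]] := ss_gap ss.
have bM : isO 0 M.
  by apply: isO_eq (isO_poly2 0 H G) => t; rewrite add0r.
have sup t : [/\ Ea *m PiP (- B t) = 0, PiP (B t) *m Ec = 0 &
    PiP (B t) *m PiP (- B t) = 0].
  have EB : Eb *m B t = B t by rewrite /B !mulmxA (ss_bb ss).
  have BE : B t *m Eb = B t by rewrite /B -!mulmxA (ss_bb ss).
  have [_ h1] := PiP_support (sB t) EB BE.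
  have h2 : Eb *m PiP (- B t) = PiP (- B t).
    by apply: (proj1 (PiP_support (symN (sB t)) _ _)); rewrite ?mulmxN ?mulNmx ?EB ?BE.
  split; last exact: PiP_mulN.
    by rewrite -h2 mulmxA (ss_ab ss) mul0mx.
  by rewrite -h1 -mulmxA (ss_bc ss) mulmx0.
apply: (@PiP_congr_congO _ _ k U _ Y Zt) => //.
- near=> t; split=> //.
  + apply: psdD; last exact/PiP_psd/sB.
    near: t; exact: near_psd_block (ss_sa ss) (ss_aa ss) c0 pa.
  + apply: psdD; last exact/PiP_psd/symN/sB.
    have -> : - M t = t *: (- H) + t ^+ 2 *: (- G) by rewrite /M; mx_ring.
    near: t; exact: near_psd_block (symN sH) (symN sG) (ss_sc ss) (ss_cc ss) c0 pc.
  have [h1 h2 h3] := sup t; rewrite -/(M t) -/(B t) /Y.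
  have hA : Ea *m Z + Ea *m M t *m Ea = (Ea *m Z + Ea *m M t *m Ea) *m Ea.
    by rewrite mulmxDl (ss_aZ ss) -!mulmxA (ss_aa ss).
  have hC : - (Ec *m Z) + Ec *m (- M t) *m Ec =
      Ec *m (- (Ec *m Z) + Ec *m (- M t) *m Ec).
    by rewrite mulmxDr !(mulmxN, mulNmx) !mulmxA (ss_cc ss).
  move: (Ea *m Z + _) (- (Ec *m Z) + _) hA hC => A C hA hC.
  rewrite mulmxDr !mulmxDl h3 addr0 hC (mulmxA (PiP _)) h2 mul0mx addr0.
  rewrite hA -[_ *m Ea *m PiP _]mulmxA h1 mulmx0 addr0.
  by rewrite (mulmxA (_ *m Ea)) -(mulmxA _ Ea) (ss_ac ss) mulmx0 mul0mx.
- apply: isOD; first apply: isOD; first exact: isO_cst.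
    by apply: (isOM (k := 0) (l := 0)); [apply: (isOM (k := 0) (l := 0)) => //|]; exact: isO_cst.
  apply: isO_PiP => //; apply: (isOM (k := 0) (l := 0)); last exact: isO_cst.
  by apply: (isOM (k := 0) (l := 0)) => //; exact: isO_cst.
- apply: isOD; first apply: isOD; first exact: isO_cst.
    apply: (isOM (k := 0) (l := 0)); last exact: isO_cst.
    by apply: (isOM (k := 0) (l := 0)); [exact: isO_cst | exact: isON].
  apply: isO_PiP => [t|]; first exact: symN.
  apply: isON; apply: (isOM (k := 0) (l := 0)); last exact: isO_cst.
  by apply: (isOM (k := 0) (l := 0)) => //; exact: isO_cst.
apply: isO_eq UZ => t; congr (_ *m _ *m _ - _).
rewrite block_diagD block_diag_id /Y -/(M t) -/(B t) PiPN // /block_diag -/(B t) mulmxN mulNmx.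
rewrite -{1}ZE (ss_aZ ss) (ss_cZ ss) -!(mulmxA Z) (ss_aa ss) (ss_cc ss).
move: (B t) (Ea *m _ *m _) (Ec *m _ *m _) (Z *m Ea) (Z *m Ec) (PiP _) => *.
mx_ring.
Unshelve. all: by end_near. Qed.

Lemma PiP_pos_scale (t : R) G : 0 <= t -> sym G -> PiP (t *: G) = t *: PiP G.
Proof.
move=> t0 sG; have [p q o _ _] := PiP_spec sG.
have o' : ip (t *: PiP G) (t *: (PiP G - G)) = 0.
  by rewrite ipZl ipZr /ip o mxtrace0 !mulr0.
have [<- _] := moreau_unique (psdZ t0 p) (psdZ t0 q) o'.
by congr PiP; mx_ring.
Qed.

(** The coefficient of [t] in U (Ea Z + t (Ea H Ea + PiP (Eb H Eb))) U^T for U = 1 + t S H, where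
    [S H] is skew. *)
Definition first_order H :=
  S H *m (Ea *m Z) - Ea *m Z *m S H + Ea *m H *m Ea + PiP (Eb *m H *m Eb).

Lemma PiP_jet1 H : sym H ->
  jet1 (fun t => PiP (Z + t *: H)) (PiP Z) (first_order H).
Proof.
move=> sH; pose X := S H; have XT : X^T = - X by exact: (ss_skew ss).
(* Skewness of [X] gives U^T U = 1 + O(t^2), and the Sylvester equation cancels the off-diagonal
   blocks of [H] at order [t]. The zero coefficient makes the second-order calculus applicable
   before truncation by [jet21]. *)
pose U t := 1%:M + t *: X + t ^+ 2 *: (0 : 'M[R]_n).
have jU : jet2 U 1%:M X 0 by exact: jet2_poly.
have jUT : jet2 (fun t => (U t)^T) 1%:M (- X) 0.
  by apply: jet2_eq (jet2_tr jU); rewrite ?trmx1 ?trmx0.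
have e := @PiP_block_congO 2 U (fun t => Z + t *: H) H 0 sH (sym0 R n).
have {e} : congO 2 (fun t => PiP (Z + t *: H)) (fun t => U t *m
    (Ea *m Z + Ea *m (t *: H + t ^+ 2 *: 0) *m Ea
      + PiP (Eb *m (t *: H + t ^+ 2 *: 0) *m Eb)) *m (U t)^T).
  apply: e => [t||]; first by apply/symD/symZ.
    have := jet21 (jet2M jUT jU); move/congO_trans; apply; apply: congO_refl => t.
    by rewrite mulmx1 mul1mx mulmx1 subrr scaler0 addr0.
  have jB : jet2 (fun t => block_diag (Z + (t *: H + t ^+ 2 *: 0))) Z (block_diag H) 0.
    by apply: congO_refl => t; rewrite !(scaler0, addr0) block_diagD block_diag_id block_diagZ.
  have := jet21 (jet2M (jet2M jU jB) jUT); move/congO_trans; apply; apply: congO_refl => t.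
  rewrite !mulmx1 !mul1mx mulmxN; have := ss_syl ss H; rewrite -/X -/(block_diag H).
  move: (X *m Z) (Z *m X) (block_diag H) => A B D AB.
  have -> : D = H - (A - B) by rewrite AB; mx_ring.
  mx_ring.
move=> /congO_trans; apply.
have jX : jet2 (fun t => Ea *m Z + t *: (Ea *m H *m Ea + PiP (Eb *m H *m Eb)))
    (Ea *m Z) (Ea *m H *m Ea + PiP (Eb *m H *m Eb)) 0.
  by apply: congO_refl => t; rewrite scaler0 addr0.
apply: (@congO_trans _ _ 2 _ (fun t => U t *m
    (Ea *m Z + t *: (Ea *m H *m Ea + PiP (Eb *m H *m Eb))) *m (U t)^T)).
  apply: congO_near; near=> t; congr (_ *m _ *m _).
  have t0 : 0 < t by near: t; exact: nbhs_right_gt.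
  have sB : sym (Eb *m H *m Eb) by apply: sym_conj_sym => //; exact: ss_sb ss.
  rewrite scaler0 addr0 -!scalemxAr -!scalemxAl PiP_pos_scale ?(ltW t0) //.
  by rewrite scalerDr addrA.
have := jet21 (jet2M (jet2M jU jX) jUT); move/congO_trans; apply; apply: congO_refl => t.
rewrite PiP_split /first_order -/X !mulmx1 !mul1mx mulmxN.
move: (X *m _) (_ *m X) (PiP _) (Ea *m H *m Ea) => *.
mx_ring.
Unshelve. all: by end_near. Qed.

Lemma dd_first_order H : sym H -> dd (@PiP R n) Z H = first_order H.
Proof. by move/PiP_jet1/dd_jet1. Qed.

End Expansion.

Section FirstOrder.
Variables (R : realType) (n : nat).
Implicit Types (B V : 'M[R]_n).

Lemma dd_PiP_jet1 B V : sym B -> sym V ->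
  jet1 (fun t => PiP (B + t *: V)) (PiP B) (dd (@PiP R n) B V).
Proof.
move=> sB sV; have [Ea [Eb [Ec [Bd [S ss]]]]] := sign_split_exists sB.
by rewrite (dd_first_order sB ss sV); by have := PiP_jet1 sB ss sV.
Qed.

Lemma dd_PiP_scale B V (s : R) : 0 <= s -> sym B -> sym V ->
  dd (@PiP R n) B (s *: V) = s *: dd (@PiP R n) B V.
Proof.
move=> s0 sB sV; have [Ea [Eb [Ec [Bd [S ss]]]]] := sign_split_exists sB.
rewrite !(dd_first_order sB ss) //; last exact: symZ.
rewrite /first_order (ss_scale ss) -!(scalemxAr, scalemxAl) PiP_pos_scale //.
  by move: (PiP _) => *; mx_ring.
by apply: sym_conj_sym => //; exact: ss_sb ss.
Qed.

End FirstOrder.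

(** * Second-order expansion of the projection *)

Section SecondOrder.
Variables (R : realType) (n : nat) (Z Ea Eb Ec Zd : 'M[R]_n).
Variable S : 'M[R]_n -> 'M[R]_n.
Hypotheses (sZ : sym Z) (ss : sign_split Z Ea Eb Ec Zd S).
Variable H : 'M[R]_n.
Hypothesis sH : sym H.
Implicit Types (G W V : 'M[R]_n).

Let X := S H.
Let bd := block_diag Ea Eb Ec.
Let Hb := Eb *m H *m Eb.
Let Za := Ea *m Z.
Let K := Ea *m H *m Ea + PiP Hb.

(** The coefficient of [t ^+ 2] created by conjugating Z + t bd H with exp (t X): the part of W/2
    already produced by the first-order rotation. *)
Definition second_shift : 'M[R]_n :=
  2^-1 *: (X *m X *m Z + Z *m X *m X) - X *m Z *m X + X *m bd H - bd H *m X.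

(** The same coefficient for the positive part, with [Za] and [K] in place of [Z] and [bd H]. *)
Definition second_const : 'M[R]_n :=
  2^-1 *: (X *m X *m Za + Za *m X *m X) - X *m Za *m X + X *m K - K *m X.

(** The effect of a perturbation [G] at order [t ^+ 2]: as in [first_order], except that [Hb]
    already occupies order [t] in the kernel block, so the projection there is differentiated at
    [Hb]. *)
Definition second_var G : 'M[R]_n :=
  S G *m Za - Za *m S G + Ea *m G *m Ea + dd (@PiP R n) Hb (Eb *m G *m Eb).

Definition second_order W := second_const + second_var (2^-1 *: W - second_shift).

Let XT : X^T = - X. Proof. exact: (ss_skew ss). Qed.

Let sHb : sym Hb. Proof. by apply: sym_conj_sym => //; exact: ss_sb ss. Qed.

Let sbdH : sym (bd H). Proof. exact: block_diag_sym ss _ sH. Qed.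

Lemma second_shift_sym : sym second_shift.
Proof.
rewrite /sym /second_shift; move: (bd H) sbdH => D sD.
have tD A B : (A + B)^T = A^T + B^T :> 'M[R]_n by exact: linearD.
have tN A : (- A)^T = - A^T :> 'M[R]_n by exact: linearN.
have tZ a A : (a *: A)^T = a *: A^T :> 'M[R]_n by exact: linearZ.
rewrite !(tD, tN, tZ) !trmx_mul XT sZ sD !(mulmxN, mulNmx) !mulmxA !opprK.
by move: (X *m X *m Z) (Z *m X *m X) (X *m Z *m X) (X *m D) (D *m X) => *;
  mx_ring.
Qed.

Lemma PiP_jet2 W : sym W ->
  jet2 (fun t => PiP (Z + t *: H + (t ^+ 2 / 2) *: W))
    (PiP Z) (dd (@PiP R n) Z H) (second_order W).
Proof.
move=> sW; rewrite /second_order.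
have : sym (2^-1 *: W - second_shift) by apply/symB/second_shift_sym/symZ.
have : 2^-1 *: W = (2^-1 *: W - second_shift) + second_shift by mx_ring.
move: (2^-1 *: W - second_shift) => G GE sG.
(* [U] agrees with exp (t X + t^2 S G) up to order two: X^2/2 restores orthogonality at order
   [t ^+ 2], and [S G] removes the off-diagonal blocks of [G]. *)
pose Y := 2^-1 *: (X *m X) + S G; pose Y' := 2^-1 *: (X *m X) - S G.
pose U t := 1%:M + t *: X + t ^+ 2 *: Y.
have YT : Y^T = Y'.
  by rewrite /Y linearD linearZ /= trmx_mul XT (ss_skew ss sG) mulNmx mulmxN opprK.
have jU : jet2 U 1%:M X Y by exact: jet2_poly.
have jUT : jet2 (fun t => (U t)^T) 1%:M (- X) Y'.
  by apply: jet2_eq (jet2_tr jU) => //; rewrite trmx1.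
have sZt t : sym (Z + t *: H + (t ^+ 2 / 2) *: W).
  by apply: symD; [apply: symD => //; apply: symZ | apply: symZ].
have e : congO 3 (fun t => PiP (Z + t *: H + (t ^+ 2 / 2) *: W))
    (fun t => U t *m (Za + Ea *m (t *: H + t ^+ 2 *: G) *m Ea
      + PiP (Eb *m (t *: H + t ^+ 2 *: G) *m Eb)) *m (U t)^T).
  apply: (PiP_block_congO sZ ss sH sG sZt); rewrite -/bd.
    have := jet2M jUT jU; move/congO_trans; apply; apply: congO_refl => t.
  rewrite !mulmx1 !mul1mx mulNmx /Y /Y'; move: (X *m X) => *; mx_ring.
  have jB : jet2 (fun t => bd (Z + (t *: H + t ^+ 2 *: G))) Z (bd H) (bd G).
    apply: congO_refl => t; rewrite /bd.
    by rewrite !block_diagD (block_diag_id sZ ss) !block_diagZ addrA.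
  have := jet2M (jet2M jU jB) jUT; move/congO_trans; apply; apply: congO_refl => t.
  have eH : H = bd H + (X *m Z - Z *m X) by rewrite (ss_syl ss); mx_ring.
  have eG : bd G = G - (S G *m Z - Z *m S G) by rewrite (ss_syl ss); mx_ring.
  have eW : W = 2 *: (G + second_shift) by rewrite -GE; mx_ring.
  rewrite {}[in RHS]eW [in RHS]eH {}eG /Y /Y' /second_shift.
  move: G (bd H) (S G) {eH GE YT jU jUT sG jB U Y Y'} => G' D T.
  rewrite !mulmx1 !mul1mx !(mulmxDr, mulmxDl, mulmxN, mulNmx).
  rewrite -!(scalemxAr, scalemxAl) !mulmxA.
  move: (X *m X *m Z) (Z *m X *m X) (X *m Z *m X) (X *m D) (D *m X) => A1 A2 A3 A4 A5.
  move: (X *m Z) (Z *m X) (T *m Z) (Z *m T) => *.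
  mx_ring.
apply: congO_trans e _.
have sB1 : sym (Eb *m G *m Eb) by apply: sym_conj_sym => //; exact: ss_sb ss.
have jP := jet2_scale (dd_PiP_jet1 sHb sB1).
have jX := jet2D (jet2_poly Za (Ea *m H *m Ea) (Ea *m G *m Ea)) jP.
have jR := jet2M (jet2M jU jX) jUT.
apply: (@congO_trans _ _ 3 _ (fun t => U t *m
    (Za + t *: (Ea *m H *m Ea) + t ^+ 2 *: (Ea *m G *m Ea) +
      t *: PiP (Hb + t *: (Eb *m G *m Eb))) *m (U t)^T)).
  apply: congO_near; near=> t; congr (_ *m _ *m _).
  have t0 : 0 < t by near: t; exact: nbhs_right_gt.
  rewrite -PiP_pos_scale ?(ltW t0) //; last by apply/symD/symZ.
  rewrite scalerDr scalerA -expr2 !mulmxDr !mulmxDl -!(scalemxAr, scalemxAl).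
  by rewrite !addrA.
move/congO_trans: jR; apply; apply: congO_refl => t.
rewrite (PiP_split ss) (dd_first_order sZ ss sH) /first_order -/X -/Hb -/Za.
rewrite /second_var /second_const /K /Y /Y'.
rewrite !mulmx1 !mul1mx !addr0.
move: (dd (@PiP R n) Hb _) (Ea *m G *m Ea) (Ea *m H *m Ea) (PiP Hb) (S G) => D G' H' P T.
rewrite !(mulmxDr, mulmxDl, mulmxN, mulNmx) -!(scalemxAr, scalemxAl) !mulmxA.
move: (X *m X *m Za) (Za *m X *m X) (X *m Za *m X) (X *m H') (H' *m X) => A1 A2 A3 A4 A5.
move: (X *m Za) (Za *m X) (X *m P) (P *m X) (T *m Za) (Za *m T) => *.
mx_ring.
Unshelve. all: by end_near. Qed.

Lemma dd2_second_order W : sym W -> dd2 (@PiP R n) Z H W = 2 *: second_order W.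
Proof.
move=> sW; apply: dd2_jet2; rewrite scalerA mulVf ?pnatr_eq0 // scale1r.
exact: PiP_jet2.
Qed.

Lemma split_ba : Eb *m Ea = 0.
Proof. by rewrite -(ss_sb ss) -(ss_sa ss) -trmx_mul (ss_ab ss) trmx0. Qed.

Lemma split_cb : Ec *m Eb = 0.
Proof. by rewrite -(ss_sb ss) -(ss_sc ss) -trmx_mul (ss_bc ss) trmx0. Qed.

Lemma kerproj_split : kerproj Z = Eb.
Proof.
have Zb := split_mulb sZ ss.
apply: xget_unique.
  split; [exact: ss_sb ss | exact: ss_bb ss |].
  apply/andP; split; first by apply/sub_kermxP; exact: ss_bZ ss.
  have -> : kermx Z = kermx Z *m Eb.
    have := mulmx_ker Z => k0; rewrite -[LHS]mulmx1 -(ss_one ss) addrAC.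
    by rewrite -(ss_ZZd ss) mulmxDr mulmxA k0 mul0mx add0r.
  exact: submxMl.
move=> P [sP PP /andP[Pk kP]].
have /sub_kermxP PZ := Pk.
have PE : P = P *m Eb.
  rewrite -[LHS]mulmx1 -(ss_one ss) addrAC -(ss_ZZd ss) mulmxDr mulmxA.
  by rewrite PZ mul0mx add0r.
have : (Eb <= P)%MS by apply: submx_trans kP; apply/sub_kermxP; exact: ss_bZ ss.
case/submxP => D ED.
have EP : Eb *m P = Eb by rewrite ED -mulmxA PP.
by have := congr1 trmx EP; rewrite trmx_mul sP (ss_sb ss) -PE.
Qed.

Lemma pinv_split : Defs.pinv Z = Zd.
Proof.
have Zb := split_mulb sZ ss.
have sac : (Ea + Ec)^T = Ea + Ec by rewrite linearD /= (ss_sa ss) (ss_sc ss).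
have aE : Ea + Ec = 1%:M - Eb by rewrite -(ss_one ss); mx_ring.
apply: xget_unique.
  split; rewrite ?(ss_ZZd ss) ?(ss_ZdZ ss) ?sac //.
    by rewrite aE mulmxBl mul1mx (ss_bZ ss) subr0.
  by rewrite aE mulmxBl mul1mx (ss_bZd ss) subr0.
move=> Y [ZYZ YZY sZY sYZ].
have TZ : (Ea + Ec) *m Z = Z by rewrite aE mulmxBl mul1mx (ss_bZ ss) subr0.
have ZT : Z *m (Ea + Ec) = Z by rewrite aE mulmxBr mulmx1 Zb subr0.
have e1 : Z *m Y = Ea + Ec.
  have e : (Ea + Ec) *m (Z *m Y) = Z *m Y by rewrite mulmxA TZ.
  have := congr1 trmx e; rewrite trmx_mul sZY sac => <-.
  by rewrite -(ss_ZZd ss) mulmxA ZYZ.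
have e2 : Y *m Z = Ea + Ec.
  have e : (Y *m Z) *m (Ea + Ec) = Y *m Z by rewrite -mulmxA ZT.
  have := congr1 trmx e; rewrite trmx_mul sYZ sac => <-.
  by rewrite -(ss_ZdZ ss) -mulmxA (mulmxA Z) ZYZ.
rewrite -YZY e2 -(ss_ZdZ ss) -mulmxA e1 aE mulmxBr mulmx1.
by rewrite (ss_Zdb ss) subr0.
Qed.

Let eq_syl : X *m Z = Z *m X + (H - bd H).
Proof. by rewrite -(ss_syl ss); mx_ring. Qed.

(** Since [Eb] annihilates [Z] and Eb X Eb = 0, only the term - X Z X survives the compression.
    Inserting [Zd] between two copies of [Z] and evaluating Eb X Z and Z X Eb by the Sylvester
    equation leaves exactly half of [Upsilon]. *)
Lemma second_shift_kernel : Eb *m second_shift *m Eb = Eb *m H *m Zd *m H *m Eb.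
Proof.
have Zb := split_mulb sZ ss; have bb := ss_bb ss; have bZ := ss_bZ ss.
have bX : Eb *m X *m Eb = 0 by exact: (ss_Sbb ss H).
have bd_r : bd H *m Eb = Eb *m H *m Eb.
  rewrite /bd /block_diag !mulmxDl -!mulmxA bb (ss_ab ss) split_cb.
  by rewrite !mulmx0 add0r addr0.
have bd_l : Eb *m bd H = Eb *m H *m Eb.
  rewrite /bd /block_diag !mulmxDr !mulmxA bb split_ba (ss_bc ss).
  by rewrite !mul0mx add0r addr0.
have l1 : Eb *m X *m Z = Eb *m H - Eb *m H *m Eb.
  by rewrite -mulmxA eq_syl mulmxDr mulmxA bZ mul0mx add0r mulmxBr bd_l.
have r1 : Z *m X *m Eb = Eb *m H *m Eb - H *m Eb.
  have -> : Z *m X = X *m Z - (H - bd H) by rewrite eq_syl; mx_ring.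
  by rewrite mulmxBl -(mulmxA X) Zb mulmx0 sub0r mulmxBl bd_r opprB.
have m1 : Eb *m (X *m Z *m X) *m Eb = - (Eb *m H *m Zd *m H *m Eb).
  have -> : Eb *m (X *m Z *m X) *m Eb = (Eb *m X *m Z) *m Zd *m (Z *m X *m Eb).
    rewrite !mulmxA -(mulmxA _ Z Zd) (ss_ZZd ss).
    have -> : Ea + Ec = 1%:M - Eb by rewrite -(ss_one ss); mx_ring.
    by rewrite mulmxBr mulmx1 bX subr0.
  rewrite l1 r1 mulmxBl -(mulmxA _ Eb Zd) (ss_bZd ss) mulmx0 subr0.
  by rewrite mulmxBr !mulmxA -(mulmxA _ Zd Eb) (ss_Zdb ss) mulmx0 !mul0mx sub0r.
rewrite /second_shift; move: (bd H) bd_l bd_r => D bd_l bd_r.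
rewrite !(mulmxDl, mulmxDr, mulmxN, mulNmx) -!(scalemxAr, scalemxAl).
rewrite !(mulmxDl, mulmxDr) m1.
have -> : Eb *m (X *m X *m Z) *m Eb = 0 by rewrite -!mulmxA Zb !mulmx0.
have -> : Eb *m (Z *m X *m X) *m Eb = 0 by rewrite !mulmxA bZ !mul0mx.
have -> : Eb *m (X *m D) *m Eb = 0.
  by rewrite -!mulmxA bd_r !mulmxA bX !mul0mx.
have -> : Eb *m (D *m X) *m Eb = 0.
  by rewrite mulmxA bd_l -!mulmxA (mulmxA Eb X) bX !mulmx0.
by rewrite !(addr0, scaler0, oppr0, add0r, opprK).
Qed.

Lemma UpsilonE : Upsilon Z H = 2 *: (Eb *m H *m Zd *m H *m Eb).
Proof. by rewrite /Upsilon kerproj_split pinv_split. Qed.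

Lemma Upsilon_split_sym : sym (Upsilon Z H).
Proof.
rewrite UpsilonE; apply: symZ.
by rewrite /sym !trmx_mul (ss_sb ss) (ss_sZd ss) sH !mulmxA.
Qed.

(* [Upsilon] is exactly the shift cancelling the kernel block, so that the
   nonlinear term of the second derivative is centred at 0. *)
Lemma Theta_second_var V : sym V -> Theta Z H V = 2 *: second_var (2^-1 *: V).
Proof.
move=> sV; have sU := Upsilon_split_sym.
rewrite /Theta !dd2_second_order //; last exact: symD.
rewrite -scalerBr; congr (_ *: _); rewrite /second_order.
have -> : 2^-1 *: (V + Upsilon Z H) - second_shift =
    2^-1 *: V + (2^-1 *: Upsilon Z H - second_shift) by mx_ring.
have : Eb *m (2^-1 *: Upsilon Z H - second_shift) *m Eb = 0.
  rewrite mulmxBr mulmxBl second_shift_kernel UpsilonE scalerA mulVf ?pnatr_eq0 //.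
  by rewrite scale1r !mulmxA (ss_bb ss) -!mulmxA (ss_bb ss) subrr.
move: (2^-1 *: Upsilon Z H - second_shift) (2^-1 *: V) => G V' G0.
have d0 : dd (@PiP R n) Hb 0 = 0.
  by have := dd_PiP_scale (lexx 0) sHb (sym0 R n); rewrite !scale0r.
rewrite /second_var (mulmxDr Eb) (mulmxDl _ _ Eb) G0 addr0 d0 (ss_add ss).
rewrite !(mulmxDr, mulmxDl).
move: (S V' *m Za) (S G *m Za) (Za *m S V') (Za *m S G) (Ea *m V' *m Ea) => *.
by move: (Ea *m G *m Ea) (dd _ _ _) => *; mx_ring.
Qed.

Lemma second_var_scale (s : R) G : 0 <= s -> sym G ->
  second_var (s *: G) = s *: second_var G.
Proof.
move=> s0 sG; rewrite /second_var (ss_scale ss) -!(scalemxAr, scalemxAl).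
rewrite dd_PiP_scale //; last by apply: sym_conj_sym => //; exact: ss_sb ss.
by move: (dd _ _ _) => *; mx_ring.
Qed.

End SecondOrder.

(** * Properties of the second derivative, free of the spectral splitting *)

Section SecondDerivative.
Variables (R : realType) (n : nat) (Z H : 'M[R]_n).
Hypotheses (sZ : sym Z) (sH : sym H).
Implicit Types (G W V : 'M[R]_n).

Let sZt W : sym W -> forall t, sym (Z + t *: H + (t ^+ 2 / 2) *: W).
Proof. by move=> sW t; apply: symD; [apply: symD => //|]; apply: symZ. Qed.

Lemma dd2_PiP_jet2 W : sym W ->
  jet2 (fun t => PiP (Z + t *: H + (t ^+ 2 / 2) *: W))
    (PiP Z) (dd (@PiP R n) Z H) (2^-1 *: dd2 (@PiP R n) Z H W).
Proof.
move=> sW; have [Ea [Eb [Ec [Zd [S ss]]]]] := sign_split_exists sZ.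
rewrite (dd2_second_order sZ ss sH sW) scalerA mulVf ?pnatr_eq0 // scale1r.
exact: (PiP_jet2 sZ ss sH sW).
Qed.

Lemma Upsilon_sym : sym (Upsilon Z H).
Proof.
have [Ea [Eb [Ec [Zd [S ss]]]]] := sign_split_exists sZ.
exact: (Upsilon_split_sym sZ ss sH).
Qed.

Lemma Theta_scale s V : 0 <= s -> sym V -> Theta Z H (s *: V) = s *: Theta Z H V.
Proof.
move=> s0 sV; have [Ea [Eb [Ec [Zd [S ss]]]]] := sign_split_exists sZ.
rewrite !(Theta_second_var sZ ss sH) //; last exact: symZ.
rewrite scalerA mulrC -scalerA (second_var_scale ss sH s0); last exact: symZ.
by rewrite !scalerA mulrC.
Qed.

Lemma dd_PiP_sym : sym (dd (@PiP R n) Z H).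
Proof.
have jP := dd_PiP_jet1 sZ sH.
rewrite /sym; apply/esym/dd_jet1; rewrite -(PiP_sym sZ).
apply: congO_trans (congO_trans _ (congO_tr jP)) _.
  by apply: congO_refl => t; rewrite PiP_sym //; apply/symD/symZ.
by apply: congO_refl => t; mx_ring.
Qed.

Lemma dd2_PiP_sym W : sym W -> sym (dd2 (@PiP R n) Z H W).
Proof.
move=> sW; have jP := jet2_tr (dd2_PiP_jet2 sW).
rewrite /sym; apply/esym/dd2_jet2; apply: jet2_eq jP => [t|||].
- by rewrite PiP_sym //; apply: sZt.
- by rewrite PiP_sym.
- exact: dd_PiP_sym.
- by rewrite linearZ.
Qed.

Lemma dd_PiN : dd (@PiN R n) Z H = H - dd (@PiP R n) Z H.
Proof.
apply: dd_jet1; have := congOD (jet1_linear Z H) (congON (dd_PiP_jet1 sZ sH)).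
move=> j; apply: congO_trans (congO_trans _ j) _; apply: congO_refl => t.
  by rewrite PiNE //; apply/symD/symZ.
by rewrite PiNE //; mx_ring.
Qed.

Lemma dd2_PiN W : sym W -> dd2 (@PiN R n) Z H W = W - dd2 (@PiP R n) Z H W.
Proof.
move=> sW; apply: dd2_jet2.
have := jet2D (jet2_poly Z H (2^-1 *: W)) (jet2N (dd2_PiP_jet2 sW)).
apply: jet2_eq => [t|||].
- by rewrite PiNE; [mx_ring | exact: sZt].
- by rewrite PiNE.
- by rewrite dd_PiN.
- by rewrite scalerBr.
Qed.

(** The two curves differ by t^2/2 times W1 - W2, their projections by t^2/2 times [a] up to O(t^3);
    firmness of [PiP], divided by t^4, passes to the limit. *)
Lemma dd2_PiP_firm W1 W2 : sym W1 -> sym W2 ->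
  let a := dd2 (@PiP R n) Z H W1 - dd2 (@PiP R n) Z H W2 in
  0 <= ip a (W1 - W2 - a).
Proof.
move=> s1 s2 /=; set a := dd2 _ _ _ W1 - dd2 _ _ _ W2.
pose f t := PiP (Z + t *: H + (t ^+ 2 / 2) *: W1)
  - PiP (Z + t *: H + (t ^+ 2 / 2) *: W2).
have jf : isO 3 (fun t => f t - t ^+ 2 *: (2^-1 *: a)).
  have := jet2D (dd2_PiP_jet2 s1) (jet2N (dd2_PiP_jet2 s2)).
  apply: isO_eq => t; rewrite /f /a.
  by move: (PiP _) (PiP _) (PiP _) (dd _ _ _) (dd2 _ _ _ _) (dd2 _ _ _ _) => *;
    mx_ring.
pose g t := (t ^+ 2)^-1 *: f t.
have jg : congO 1 g (fun=> 2^-1 *: a).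
  apply: isO_near_eq (isOZV (k := 2) (l := 1) jf); near=> t.
  have t0 : t != 0 by rewrite gt_eqF //; near: t; exact: nbhs_right_gt.
  by rewrite scalerBr scalerA mulVf ?expf_neq0 // scale1r.
pose v := 2^-1 *: (W1 - W2).
have jv : congO 1 (fun t => v - g t) (fun=> v - 2^-1 *: a).
  by apply: isO_eq (isON jg) => t; move: v (2^-1 *: a) (g t) => *; mx_ring.
have ip4 (A V : 'M[R]_n) :
    ip A (V - A) = 4 * \tr ((2^-1 *: A) *m (2^-1 *: V - 2^-1 *: A)).
  by rewrite -scalerBr -scalemxAl -scalemxAr !mxtraceZ /ip; field.
rewrite ip4 mulr_ge0 //; apply: isO_trace_ge0 (congOM _ _ jg jv) _; try exact: isO_cst.
near=> t; have t0 : t != 0 by rewrite gt_eqF //; near: t; exact: nbhs_right_gt.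
have := PiP_firm (sZt s1 t) (sZt s2 t); rewrite -/(f t) -/(ip (g t) (v - g t)).
have -> : Z + t *: H + t ^+ 2 / 2 *: W1 - (Z + t *: H + t ^+ 2 / 2 *: W2) =
    t ^+ 2 *: v by rewrite /v; mx_ring.
have -> : f t = t ^+ 2 *: g t by rewrite scalerA mulfV ?expf_neq0 // scale1r.
move=> h; rewrite -(pmulr_rge0 _ (_ : 0 < t ^+ 2 * t ^+ 2)).
  by move: h; rewrite -scalerBr ipZl ipZr mulrA.
by rewrite -expr2 lt_neqAle sqr_ge0 eq_sym !expf_neq0.
Unshelve. all: by end_near. Qed.

Lemma sym_Theta V : sym V -> sym (Theta Z H V).
Proof.
move=> sV; have sU := Upsilon_sym.
by apply: symB; apply: dd2_PiP_sym => //; apply: symD.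
Qed.

Lemma Thetaperp_eq V : sym V -> Thetaperp Z H V = V - Theta Z H V.
Proof.
move=> sV; have sU := Upsilon_sym; rewrite /Thetaperp /Theta !dd2_PiN //.
  by move: (dd2 _ _ _ _) (dd2 _ _ _ _) => *; mx_ring.
exact: symD.
Qed.

Lemma Theta_firm V1 V2 : sym V1 -> sym V2 ->
  let a := Theta Z H V1 - Theta Z H V2 in 0 <= ip a (V1 - V2 - a).
Proof.
move=> s1 s2; have sU := Upsilon_sym.
have := dd2_PiP_firm (symD s1 sU) (symD s2 sU).
rewrite /Theta; move: (dd2 _ _ _ (V1 + _)) (dd2 _ _ _ (V2 + _)) (dd2 _ _ _ (Upsilon _ _)).
move=> A B C /=; have -> : A - C - (B - C) = A - B by mx_ring.
by have -> : V1 + Upsilon Z H - (V2 + Upsilon Z H) = V1 - V2 by mx_ring.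
Qed.

End SecondDerivative.

(** * Iteration of a firmly nonexpansive map *)

Section FrobeniusConvergence.
Variables (R : realType) (n : nat).
Implicit Types (X Y : 'M[R]_n).

Lemma cvg_entry {T : Type} {F : set_system T} {FF : Filter F}
    (f : T -> 'M[R]_n) X i j :
  f x @[x --> F] --> X -> f x i j @[x --> F] --> X i j.
Proof.
move=> fX; have c : {for X, continuous (fun A : 'M[R]_n => A i j)}.
  exact: coord_continuous.
exact: (@continuous_cvg _ _ _ F _ f (fun A : 'M[R]_n => A i j) X c fX).
Qed.

Lemma cvg_ip {T : Type} {F : set_system T} {FF : Filter F}
    (f g : T -> 'M[R]_n) X Y :
  f x @[x --> F] --> X -> g x @[x --> F] --> Y ->
  ip (f x) (g x) @[x --> F] --> ip X Y.
Proof.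
move=> fX gY.
have ipS A B : ip A B = \sum_i \sum_j A i j * B j i :> R.
  by apply: eq_bigr => i _; rewrite mxE.
rewrite ipS; under eq_cvg do rewrite ipS.
apply: cvg_big => [|i _]; first exact: add_continuous.
apply: cvg_big => [|j _]; first exact: add_continuous.
by apply: cvgM; apply: cvg_entry.
Qed.

Lemma cvg_sqnorm {T : Type} {F : set_system T} {FF : Filter F}
    (f : T -> 'M[R]_n) X :
  f x @[x --> F] --> X -> sqnorm (f x - X) @[x --> F] --> 0.
Proof.
move=> fX; have f0 : f x - X @[x --> F] --> X - X by apply: cvgB => //; exact: cvg_cst.
have -> : 0 = \sum_(i < n) \sum_(j < n) (X - X) i j ^+ 2 :> R.
  by rewrite !big1 // => i _; rewrite big1 // => j _; rewrite subrr mxE expr0n.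
under eq_cvg do rewrite sqnorm_sum.
apply: cvg_big => [|i _]; first exact: add_continuous.
apply: cvg_big => [|j _]; first exact: add_continuous.
rewrite expr2; under eq_cvg do rewrite expr2.
by apply: cvgM; apply: cvg_entry.
Qed.

(** The topology of matrices comes from the largest entry, whereas the estimates below concern the
    Frobenius norm; comparing squares avoids a root. *)
Lemma mx_norm_le_sqnorm X (e : R) : 0 <= e -> sqnorm X <= e ^+ 2 -> `|X| <= e.
Proof.
move=> e0 Xe; rewrite /Num.norm /= mx_normrE; apply: bigmax_le => // -[i j] _ /=.
rewrite -(@ler_pXn2r _ 2) ?nnegrE // real_normK ?num_real //.
exact: le_trans (entry_sqnorm _ _ _) Xe.
Qed.

Lemma sqnorm_cvg {T : Type} {F : set_system T} {FF : Filter F}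
    (f : T -> 'M[R]_n) X :
  sqnorm (f x - X) @[x --> F] --> 0 -> f x @[x --> F] --> X.
Proof.
move=> f0; apply/cvgrPdist_le => e e0.
have e2 : 0 < e ^+ 2 by rewrite exprn_gt0.
apply: (filterS _ (cvgr_dist_le _ _ f0 _ e2)) => x /=.
rewrite sub0r normrN ger0_norm ?sqnorm_ge0 // -opprB sqnormN.
by apply: mx_norm_le_sqnorm; rewrite ltW.
Qed.

Lemma sqnorm_cauchy (x : nat -> 'M[R]_n) :
  (forall e : R, 0 < e -> exists N, forall k, (N <= k)%N -> sqnorm (x k - x N) <= e) ->
  exists X, x k @[k --> \oo] --> X.
Proof.
move=> cx; apply/cvg_ex; apply/cauchy_cvgP; apply: cauchy_exP => e e0.
have [|N xN] := cx ((e / 2) ^+ 2); first by rewrite exprn_gt0 // divr_gt0.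
exists (x N); exists N => // k /= Nk.
rewrite -ball_normE /=; apply: (@le_lt_trans _ _ (e / 2)).
  by apply: mx_norm_le_sqnorm; [rewrite ltW // divr_gt0 | rewrite -opprB sqnormN xN].
by rewrite ltr_pdivrMr // ltr_pMr // ltr1n.
Qed.

Lemma sqnormDl X Y : sym X -> sqnorm (X + Y) = sqnorm X + 2 * ip X Y + sqnorm Y.
Proof.
move=> sX; have e : \tr (Y^T *m X) = ip X Y by rewrite -mxtrace_tr trmx_mul trmxK sX.
rewrite /sqnorm (_ : (X + Y)^T = X + Y^T) ?sX; last by rewrite linearD /= sX.
by rewrite mulmxDl !mulmxDr !mxtraceD e /ip; ring.
Qed.

Lemma sqnorm_young X Y (e : R) : sym X -> sym Y -> 0 < e ->
  sqnorm (X + Y) <= (1 + e) * sqnorm X + (1 + e^-1) * sqnorm Y.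
Proof.
move=> sX sY e0; have := sqnorm_ge0 (e *: X - Y).
rewrite sqnormB ?sqnormDl //; last exact: symZ.
rewrite sqnormZ ipZl => h.
have : 0 <= e^-1 * (e ^+ 2 * sqnorm X - 2 * (e * ip X Y) + sqnorm Y).
  by rewrite mulr_ge0 // invr_ge0 ltW.
have -> : e^-1 * (e ^+ 2 * sqnorm X - 2 * (e * ip X Y) + sqnorm Y) =
  e * sqnorm X - 2 * ip X Y + e^-1 * sqnorm Y by field; rewrite gt_eqF.
by rewrite !mulrDl !mul1r; lra.
Qed.

Lemma sqnormD_le X Y : sym X -> sym Y ->
  sqnorm (X + Y) <= 2 * sqnorm X + 2 * sqnorm Y.
Proof. by move=> sX sY; have := sqnorm_young sX sY ltr01; rewrite invr1. Qed.

Lemma cvg_sym (x : nat -> 'M[R]_n) X : (forall k, sym (x k)) ->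
  x k @[k --> \oo] --> X -> sym X.
Proof.
move=> sx xX; apply/matrixP => i j; rewrite mxE.
have h1 : x k j i @[k --> \oo] --> X j i by exact: cvg_entry.
have h2 : x k j i @[k --> \oo] --> X i j.
  have -> : (fun k => x k j i) = (fun k => x k i j).
    by apply/funext => k; rewrite -{1}(sx k) mxE.
  exact: cvg_entry.
exact: (cvg_unique _ h1 h2).
Qed.

End FrobeniusConvergence.

(** * Resolvents of a firmly nonexpansive map and their limit *)

Section FirmIteration.
Variables (R : realType) (n : nat) (M : 'M[R]_n -> 'M[R]_n).
Hypothesis M_sym : forall V, sym V -> sym (M V).
Hypothesis M_firm : forall U V, sym U -> sym V ->
  0 <= ip (M U - M V) (U - V - (M U - M V)).
Implicit Types (U V X Y p q u : 'M[R]_n).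

Lemma firm_sqnorm U V : sym U -> sym V ->
  sqnorm (U - V - (M U - M V)) + sqnorm (M U - M V) <= sqnorm (U - V).
Proof.
move=> sU sV; have := M_firm sU sV.
have sM : sym (M U - M V) by apply: symB; apply: M_sym.
have sD : sym (U - V) by exact: symB.
rewrite sqnormB // ipDr ipNr -(sqnorm_ip sM) (ipC (U - V)).
by lra.
Qed.

Lemma firm_nonexpansive U V : sym U -> sym V -> sqnorm (M U - M V) <= sqnorm (U - V).
Proof.
move=> sU sV; have := firm_sqnorm sU sV.
by have := sqnorm_ge0 (U - V - (M U - M V)); lra.
Qed.

Lemma firm_cvg (x : nat -> 'M[R]_n) X : (forall k, sym (x k)) ->
  x k @[k --> \oo] --> X -> M (x k) @[k --> \oo] --> M X.
Proof.
move=> sx xX; have sX := cvg_sym sx xX.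
apply: sqnorm_cvg; apply: squeeze_cvgr (cvg_cst 0) (cvg_sqnorm xX).
by apply: nearW => k; rewrite sqnorm_ge0 firm_nonexpansive.
Qed.

(* Picard iteration for the contraction p -> (p - M p + l *: y) / (1 + l). *)
Lemma resolvent_exists y (l : R) : sym y -> 0 < l ->
  exists2 p, sym p & l *: p + M p = l *: y.
Proof.
move=> sy l0; pose c := (1 + l)^-1; have l1 : 0 < 1 + l by rewrite ltr_pwDl // ltW.
pose Phi p := c *: (p - M p + l *: y).
have sPhi p : sym p -> sym (Phi p).
  by move=> sp; apply/symZ/symD/symZ => //; apply: symB => //; exact: M_sym.
have c0 : 0 < c by rewrite invr_gt0.
have c1 : c < 1 by rewrite invf_lt1 // ltrDl.
pose q := c ^+ 2; have q0 : 0 < q by rewrite exprn_gt0.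
have q1 : q < 1 by rewrite exprn_ilt1 // ltW.
have Phi_le p p' : sym p -> sym p' -> sqnorm (Phi p - Phi p') <= q * sqnorm (p - p').
  move=> sp sp'; have -> : Phi p - Phi p' = c *: (p - p' - (M p - M p')).
    by rewrite /Phi; mx_ring.
  rewrite sqnormZ ler_wpM2l ?(ltW q0) //; have := firm_sqnorm sp sp'.
  by have := sqnorm_ge0 (M p - M p'); lra.
pose u k := iter k Phi 0.
have su k : sym (u k) by elim: k => [|k IH]; [exact: sym0 | exact: sPhi].
have geo k m : sqnorm (u (m + k)%N - u k) <= q ^+ k * sqnorm (u m).
  elim: k => [|k IH]; first by rewrite addn0 subr0 expr0 mul1r.
  rewrite addnS /= exprS -mulrA; apply: le_trans (Phi_le _ _ _ _) _ => //.
  by rewrite ler_wpM2l // ltW.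
(* [e] is chosen so that (1 + e) q = (1 + q)/2; the margin (1 - q)/2 then dictates [B], a bound
   which the induction reproduces exactly. *)
pose e := (1 - q) / 2 / q; have e0 : 0 < e by rewrite !divr_gt0 ?subr_gt0.
pose B := (1 + e^-1) * sqnorm (Phi 0) / ((1 - q) / 2).
have B0 : 0 <= B.
  have h : 0 <= (1 - q) / 2 by rewrite divr_ge0 // subr_ge0 ltW.
  have h' : 0 <= 1 + e^-1 by rewrite addr_ge0 // invr_ge0 ltW.
  by apply: divr_ge0 => //; apply: mulr_ge0 => //; exact: sqnorm_ge0.
have uB k : sqnorm (u k) <= B.
  elim: k => [|k IH]; first by rewrite /u /= /sqnorm mulmx0 mxtrace0.
  have -> : u k.+1 = (Phi (u k) - Phi 0) + Phi 0 by rewrite subrK.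
  have sP0 := sPhi _ (sym0 R n).
  apply: le_trans (sqnorm_young (symB (sPhi _ (su k)) sP0) sP0 e0) _.
  have := Phi_le _ _ (su k) (sym0 R n); rewrite subr0 => h.
  have h2 : (1 + e) * sqnorm (Phi (u k) - Phi 0) <= (1 + e) * (q * B).
    rewrite ler_wpM2l ?addr_ge0 ?(ltW e0) //; apply: le_trans h _.
    by rewrite ler_wpM2l // ltW.
  apply: le_trans (lerD h2 (lexx _)) _; rewrite le_eqVlt; apply/orP; left; apply/eqP.
  have -> : (1 + e^-1) * sqnorm (Phi 0) = B * ((1 - q) / 2).
    by rewrite /B divfK // gt_eqF // divr_gt0 ?subr_gt0.
  by move: B {B0 IH h2} => B; rewrite /e; field; rewrite gt_eqF.
have [p up] : exists p, u k @[k --> \oo] --> p.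
  apply: sqnorm_cauchy => d d0.
  have : geometric B q k @[k --> \oo] --> 0 by apply: cvg_geometric; rewrite ger0_norm // ltW.
  move=> /cvgr_dist_le/(_ d d0)[N _ hN]; exists N => k Nk.
  rewrite -(subnK Nk); apply: le_trans (geo _ _) _.
  have := hN N (leqnn N); rewrite /geometric /= sub0r normrN ger0_norm; last first.
    by rewrite mulr_ge0 // exprn_ge0 // ltW.
  apply: le_trans; rewrite mulrC ler_wpM2r // ?exprn_ge0 // ?ltW //.
have sp := cvg_sym su up.
have PhiE : Phi p = p.
  have h1 : u k.+1 @[k --> \oo] --> p by rewrite cvg_shiftS.
  have h2 : u k.+1 @[k --> \oo] --> Phi p.
    apply: cvgZ; first exact: cvg_cst.
    by apply: cvgD; [apply: cvgB => //; exact: firm_cvg | exact: cvg_cst].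
  exact: (cvg_unique _ h2 h1).
exists p => //; have : (1 + l) *: Phi p = (1 + l) *: p by rewrite PhiE.
rewrite scalerA mulfV ?gt_eqF // scale1r => h.
have -> : M p = (p + l *: y) - (p - M p + l *: y) by mx_ring.
by rewrite h; mx_ring.
Qed.

Variable y : 'M[R]_n.
Hypothesis sy : sym y.
Hypothesis M_scale : forall (s : R) V, 0 <= s -> sym V -> M (s *: V) = s *: M V.

Let a_ (k : nat) : R := k.+1%:R.
Let a_gt0 k : 0 < a_ k. Proof. exact: ltr0Sn. Qed.

Lemma resolvent_seq : exists p : nat -> 'M[R]_n,
  forall k, sym (p k) /\ p k + a_ k *: M (p k) = y.
Proof.
suff h k : {p | sym p /\ p + a_ k *: M p = y}.
  by exists (fun k => sval (h k)) => k; case: (h k).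
apply: cid; have ak0 : 0 < (a_ k)^-1 by rewrite invr_gt0.
have [p sp /(congr1 (fun X => a_ k *: X))] := resolvent_exists sy ak0.
rewrite scalerDr !scalerA mulfV ?gt_eqF // !scale1r => pE.
by exists p.
Qed.

(** By homogeneity M (a p) = y - p and M (b q) = y - q, so monotonicity at [a p] and [b q] gives <q
    - p, a p - b q> >= 0, that is (a + b)|p - q|^2 <= (a - b)(|q|^2 - |p|^2). When a = b this forces
    p = q. *)
Lemma resolvent_dist p q (a b : R) : sym p -> sym q -> 0 < b -> b <= a ->
  p + a *: M p = y -> q + b *: M q = y -> sqnorm (p - q) <= sqnorm q - sqnorm p.
Proof.
move=> sp sq b0 ba pE qE; have a0 : 0 < a by exact: lt_le_trans ba.
have mon : 0 <= ip (M (a *: p) - M (b *: q)) (a *: p - b *: q).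
  have sap := symZ a sp; have sbq := symZ b sq.
  have := M_firm sap sbq; rewrite ipDr ipNr -sqnorm_ip; last by apply: symB; apply: M_sym.
  by have := sqnorm_ge0 (M (a *: p) - M (b *: q)); lra.
move: mon; rewrite !M_scale // ?(ltW a0) ?(ltW b0) //.
have -> : a *: M p = y - p by rewrite -pE; mx_ring.
have -> : b *: M q = y - q by rewrite -qE; mx_ring.
have -> : y - p - (y - q) = q - p by mx_ring.
rewrite !ipE -!sqnorm_ip // (ipC q p) => h.
rewrite sqnormB //.
have ab0 : 0 < a + b by rewrite addr_gt0.
have h2 : a * sqnorm p + b * sqnorm q <= (a + b) * ip p q by lra.
have h3 : (a + b) * (sqnorm p - 2 * ip p q + sqnorm q) <=
    (a - b) * (sqnorm q - sqnorm p) by lra.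
have pq0 : 0 <= sqnorm p - 2 * ip p q + sqnorm q by rewrite -sqnormB // sqnorm_ge0.
have qp : 0 <= sqnorm q - sqnorm p \/ a = b.
  have [->|neq] := eqVneq a b; first by right.
  left; rewrite -(@pmulr_rge0 _ (a - b)) ?subr_gt0 ?lt_neqAle 1?eq_sym ?neq //.
  by apply: le_trans h3; rewrite mulr_ge0 // ltW.
case: qp => [qp|e].
  rewrite -(ler_pM2l ab0); apply: le_trans h3 _; rewrite ler_wpM2r //.
  by rewrite lerD2l; lra.
have z : sqnorm p - 2 * ip p q + sqnorm q <= 0.
  by rewrite -(ler_pM2l ab0) mulr0; move: h3; rewrite e subrr mul0r.
have : sqnorm (p - q) <= 0 by rewrite sqnormB.
by move/sqnorm_eq0/eqP; rewrite subr_eq0 => /eqP <-; rewrite -sqnorm_ip //; lra.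
Qed.

(** The squared norms are nonincreasing along [p] and their drops bound the squared distances, so
    [p] is Cauchy; M (p k) is y - p k divided by [k.+1], hence tends to 0. *)
Lemma resolvent_limit : exists (p : nat -> 'M[R]_n) X,
  [/\ forall k, sym (p k) /\ p k + a_ k *: M (p k) = y,
      p k @[k --> \oo] --> X & M X = 0].
Proof.
have [p pP] := resolvent_seq; exists p.
have dist k l : (k <= l)%N -> sqnorm (p l - p k) <= sqnorm (p k) - sqnorm (p l).
  move=> kl; have [[sk ek] [sl el]] := (pP k, pP l).
  by apply: (resolvent_dist sl sk (a_gt0 k) _ el ek); rewrite ler_nat ltnS.
have ni : {homo (fun k => sqnorm (p k)) : k l / (k <= l)%N >-> l <= k}.
  by move=> k l /dist h; have := sqnorm_ge0 (p l - p k); lra.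
have cv : cvgn (fun k => sqnorm (p k)).
  apply: nonincreasing_is_cvgn ni _; exists 0 => _ [k _ <-]; exact: sqnorm_ge0.
have [X pX] : exists X, p k @[k --> \oo] --> X.
  apply: sqnorm_cauchy => e e0.
  have := cvgr_dist_le _ _ cv _ e0; case=> N _ hN; exists N => k Nk.
  apply: le_trans (dist _ _ Nk) _; have := hN N (leqnn N) => /= h.
  have : limn (fun k => sqnorm (p k)) <= sqnorm (p k) by exact: nonincreasing_cvgn_ge.
  have := ler_norm (- (limn (fun k => sqnorm (p k)) - sqnorm (p N))).
  by have := le_trans (ler_norm _) h; rewrite normrN => h1 h2 h3; lra.
exists X; split=> //.
have sp k := proj1 (pP k).
have h1 := firm_cvg sp pX.
have h2 : M (p k) @[k --> \oo] --> (0 : R) *: (y - X).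
  have -> : (fun k => M (p k)) = (fun k => harmonic k *: (y - p k)).
    apply/funext => k; have [_ e] := pP k.
    have -> : y - p k = a_ k *: M (p k) by rewrite -{1}e addrC addKr.
    by rewrite scalerA mulVf ?scale1r // gt_eqF.
  by apply: cvgZ; [exact: cvg_harmonic | apply: cvgB => //; exact: cvg_cst].
by rewrite scale0r in h2; exact: (cvg_unique _ h1 h2).
Qed.

End FirmIteration.

(** * Variational inequality and limit of the increments *)

Section FirmLimit.
Variables (R : realType) (n : nat) (M : 'M[R]_n -> 'M[R]_n).
Hypothesis M_sym : forall V, sym V -> sym (M V).
Hypothesis M_firm : forall U V, sym U -> sym V ->
  0 <= ip (M U - M V) (U - V - (M U - M V)).
Variable y : 'M[R]_n.
Hypothesis sy : sym y.
Hypothesis M_scale : forall (s : R) V, 0 <= s -> sym V -> M (s *: V) = s *: M V.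
Implicit Types (U V X Y u : 'M[R]_n).

Variables (p : nat -> 'M[R]_n) (X : 'M[R]_n).
Hypothesis pP : forall k, sym (p k) /\ p k + k.+1%:R *: M (p k) = y.
Hypothesis pX : p k @[k --> \oo] --> X.

Let sp k : sym (p k). Proof. by case: (pP k). Qed.

Lemma firm_limit_sym : sym X.
Proof. exact: cvg_sym sp pX. Qed.

Let Mp k : M (k.+1%:R *: p k) = y - p k.
Proof.
by case: (pP k) => _ <-; rewrite M_scale // addrC addKr.
Qed.

(** Monotonicity of [M] is applied to [u] and to [k.+1] times [p k], whose image is [y - p k]. After
    division by [k.+1] the first factor is p k - u/(k+1), so [u] disappears from it in the limit. *)
Lemma firm_limit_variational u : sym u -> 0 <= ip X (y - X - M u).
Proof.
move=> su.
have h : ip (p k - harmonic k *: u) (y - p k - M u) @[k --> \oo] -->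
    ip (X - (0 : R) *: u) (y - X - M u).
  apply: cvg_ip; apply: cvgB => //.
  - by apply: cvgZ; [exact: cvg_harmonic | exact: cvg_cst].
  - by apply: cvgB => //; exact: cvg_cst.
  - exact: cvg_cst.
rewrite scale0r subr0 in h; apply: (cvgr_to_ge h); apply: nearW => k.
have k0 : 0 < k.+1%:R :> R by exact: ltr0Sn.
have -> : p k - harmonic k *: u = harmonic k *: (k.+1%:R *: p k - u).
  by rewrite scalerBr scalerA mulVf ?scale1r // gt_eqF.
rewrite ipZl mulr_ge0 //; first by rewrite invr_ge0 ltW.
have := M_firm (symZ k.+1%:R (sp k)) su; rewrite Mp.
have sd : sym (y - p k - M u) by do 2?apply: symB => //; exact: M_sym.
rewrite ipDr ipNr -(sqnorm_ip sd) ipC.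
by have := sqnorm_ge0 (y - p k - M u); lra.
Qed.

Let K := closure [set M V | V in @sym R n].

(** [y - X] lies in [K] as the limit of the images of [k.+1] times [p k]. The variational inequality
    extends to [K] by continuity and makes |X|^2 + |y - X - Y|^2 a lower bound for |y - Y|^2, whence
    both minimality and uniqueness. *)
Lemma firm_limit_proj : Defs.proj K y = y - X.
Proof.
have sX := firm_limit_sym.
have KX : K (y - X).
  have h : y - p k @[k --> \oo] --> y - X by apply: cvgB => //; exact: cvg_cst.
  move=> B /h[N _ hN]; exists (y - p N); split; last exact: (hN N (leqnn N)).
  by exists (N.+1%:R *: p N) => //; exact: symZ.
have var Y : K Y -> 0 <= ip X (y - X - Y).
  have gc : continuous (fun Y => ip X (y - X - Y)).
    move=> Z; apply: (@cvg_ip _ _ _ (nbhs Z) _ (fun=> X) (fun Y => y - X - Y)).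
      exact: cvg_cst.
    by apply: (@cvgB _ _ _ (nbhs Z)); [exact: cvg_cst | exact: cvg_id].
  move=> KY; have : closure [set Y | 0 <= ip X (y - X - Y)] Y.
    by apply: closure_subset KY => _ [u su <-]; exact: firm_limit_variational.
  exact: (@preimage_closed _ _ (fun Y => ip X (y - X - Y)) [set x | 0 <= x]
    (fun Y _ => gc Y) (@closed_ge _ 0) Y).
have dec Y : K Y -> sqnorm X + sqnorm (y - X - Y) <= sqnorm (y - Y).
  move=> /var h; have -> : y - Y = X + (y - X - Y) by mx_ring.
  by rewrite (sqnormDl _ sX); lra.
have yX : y - (y - X) = X by mx_ring.
apply: xget_unique.
  split=> // Y /dec; rewrite yX.
  by have := sqnorm_ge0 (y - X - Y); lra.
move=> U [KU /(_ _ KX)]; rewrite yX => h; apply/eqP.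
rewrite eq_sym -subr_eq0; apply/eqP/sqnorm_eq0.
by have := dec _ KU; lra.
Qed.

Let step V := V + (y - M V).

Let sstep k V : sym V -> sym (iter k step V).
Proof.
by move=> sV; elim: k => //= k IH; apply: symD => //; apply: symB => //; exact: M_sym.
Qed.

Let D V k := y - M (iter k step V).

Let sD V k : sym V -> sym (D V k).
Proof. by move=> sV; apply: symB => //; exact/M_sym/sstep. Qed.

Let D_step V k : sym V -> sqnorm (D V k.+1) <= sqnorm (D V k).
Proof.
move=> sV; have := firm_sqnorm M_sym M_firm (sstep k.+1 sV) (sstep k sV).
have e : iter k.+1 step V - iter k step V = D V k by rewrite /= /step addrC addKr.
rewrite e.
have -> : D V k - (M (iter k.+1 step V) - M (iter k step V)) = D V k.+1.
  by rewrite /D; mx_ring.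
by have := sqnorm_ge0 (M (iter k.+1 step V) - M (iter k step V)); lra.
Qed.

(** The variational inequality says <X, D - X> >= 0, so |D - X|^2 <= |D|^2 - |X|^2, and |D| never
    grows: an orbit whose first increment is nearly as short as [X] stays near it. *)
Let D_gap V k : sym V -> sqnorm (D V k - X) <= sqnorm (D V 0) - sqnorm X.
Proof.
move=> sV; have le0 : sqnorm (D V k) <= sqnorm (D V 0).
  by elim: k => // k IH; apply: le_trans IH; exact: D_step.
have := firm_limit_variational (sstep k sV).
have -> : y - X - M (iter k step V) = D V k - X by rewrite /D; mx_ring.
have e : D V k = X + (D V k - X) by rewrite addrC subrK.
move: le0; rewrite {1}e (sqnormDl _ firm_limit_sym); lra.
Qed.

(* Two orbits have asymptotically equal increments: firm nonexpansiveness makes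
   the squared differences of the increments summable. *)
Let D_merge V U : sym V -> sym U -> sqnorm (D V k - D U k) @[k --> \oo] --> 0.
Proof.
move=> sV sU; pose r k := sqnorm (iter k step V - iter k step U).
have rS k : r k.+1 + sqnorm (D V k - D U k) <= r k.
  have := firm_sqnorm M_sym M_firm (sstep k sV) (sstep k sU).
  have -> : iter k step V - iter k step U - (M (iter k step V) - M (iter k step U))
      = iter k.+1 step V - iter k.+1 step U by rewrite /= /step; mx_ring.
  have -> : D V k - D U k = - (M (iter k step V) - M (iter k step U)).
    by rewrite /D; mx_ring.
  by rewrite sqnormN.
have cr : cvgn r.
  apply: nonincreasing_is_cvgn; last by exists 0 => _ [k _ <-]; exact: sqnorm_ge0.
  apply/nonincreasing_seqP => k; have := rS k.
  by have := sqnorm_ge0 (D V k - D U k); lra.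
have h : r k - r k.+1 @[k --> \oo] --> (0 : R).
  rewrite -(subrr (limn r)); apply: cvgB => //.
  by rewrite (cvg_shiftS r).
apply: squeeze_cvgr (cvg_cst 0) h; apply: nearW => k.
by rewrite sqnorm_ge0; have := rS k; lra.
Qed.

Lemma firm_iteration_cvg V0 : sym V0 ->
  y - M (iter k (fun V => V + (y - M V)) V0) @[k --> \oo] --> X.
Proof.
move=> sV0; apply: sqnorm_cvg; apply/cvgrPdist_le => e e0.
(* Two errors of e/4, each doubled by [sqnormD_le]. *)
have e4 : 0 < e / 4 by rewrite divr_gt0.
have sX := firm_limit_sym.
have [N hN] : exists N, sqnorm (p N) - sqnorm X <= e / 4.
  have h : sqnorm (p k) @[k --> \oo] --> sqnorm X.
    rewrite sqnorm_ip // (_ : (fun k => sqnorm (p k)) = (fun k => ip (p k) (p k))).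
      exact: cvg_ip.
    by apply/funext => k; rewrite sqnorm_ip.
  have [N _ hN] := cvgr_dist_le _ _ h _ e4; exists N.
  have /= := hN N (leqnn N); have := ler_norm (- (sqnorm X - sqnorm (p N))).
  by rewrite normrN; lra.
pose u := N.+1%:R *: p N; have su : sym u by exact: symZ.
have Du k : sqnorm (D u k - X) <= e / 4.
  by apply: le_trans (D_gap k su) _; have -> : D u 0 = p N by rewrite /D /= /u Mp; mx_ring.
near=> k; rewrite sub0r normrN ger0_norm ?sqnorm_ge0 //.
have -> : y - M (iter k (fun V => V + (y - M V)) V0) - X =
  (D V0 k - D u k) + (D u k - X) by rewrite -[LHS]/(D V0 k - X); mx_ring.
apply: le_trans (sqnormD_le _ _) _; try by apply: symB => //; exact: sD.
have : `|0 - sqnorm (D V0 k - D u k)| <= e / 4.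
  by near: k; exact: (cvgr_dist_le _ _ (D_merge sV0 su) _ e4).
rewrite sub0r normrN ger0_norm ?sqnorm_ge0 //; have := Du k; lra.
Unshelve. all: by end_near. Qed.

End FirmLimit.

(** * Splitting along the constraint projection *)

Section ConstraintProjection.
Variables (R : realType) (n m : nat) (A : 'I_m -> 'M[R]_n).
Hypothesis sA : forall i, sym (A i).
Hypothesis surj : forall c : 'cV[R]_m, exists X, sym X /\ Aop A X = c.
Implicit Types (X Y : 'M[R]_n) (c : 'cV[R]_m).

Lemma AopD X Y : Aop A (X + Y) = Aop A X + Aop A Y.
Proof. by apply/colP => i; rewrite !mxE ipDr. Qed.

Lemma AopZ a X : Aop A (a *: X) = a *: Aop A X.
Proof. by apply/colP => i; rewrite !mxE ipZr. Qed.

Lemma Aadj_sym c : sym (Aadj A c).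
Proof. by apply: sym_sum => i _; apply/symZ/sA. Qed.

Lemma PopD X Y : Pop A (X + Y) = Pop A X + Pop A Y.
Proof.
rewrite /Pop AopD mulmxDr /Aadj -big_split; apply: eq_bigr => i _.
by rewrite mxE scalerDl.
Qed.

Lemma PopZ a X : Pop A (a *: X) = a *: Pop A X.
Proof.
rewrite /Pop AopZ -scalemxAr /Aadj scaler_sumr; apply: eq_bigr => i _.
by rewrite mxE scalerA.
Qed.

Lemma PopN X : Pop A (- X) = - Pop A X.
Proof. by rewrite -scaleN1r PopZ scaleN1r. Qed.

Lemma PopB X Y : Pop A (X - Y) = Pop A X - Pop A Y.
Proof. by rewrite PopD PopN. Qed.

Lemma Pop_sym X : sym (Pop A X). Proof. exact: Aadj_sym. Qed.

Lemma ip_Aadj c X : ip (Aadj A c) X = \sum_i c i 0 * Aop A X i 0.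
Proof.
rewrite /ip /Aadj mulmx_suml raddf_sum /=; apply: eq_bigr => i _.
by rewrite -scalemxAl mxtraceZ mxE.
Qed.

Lemma Aop_Aadj c : Aop A (Aadj A c) = AAadj A *m c.
Proof.
apply/colP => i; rewrite !mxE ipC ip_Aadj; apply: eq_bigr => j _.
by rewrite !mxE ipC mulrC.
Qed.

Lemma AAadj_tr : (AAadj A)^T = AAadj A.
Proof. by apply/matrixP => i j; rewrite !mxE ipC. Qed.

(** The squared norm of [Aadj A c] is the quadratic form of [AAadj A] at [c], so [Aadj A c]
    vanishes; pairing it with a preimage [X] of [c] gives the sum of the squared entries of [c]. *)
Lemma AAadj_inj c : AAadj A *m c = 0 -> c = 0.
Proof.
move=> c0; have Ac : Aadj A c = 0.
  apply: sqnorm_eq0; rewrite sqnorm_ip ?ip_Aadj; last exact: Aadj_sym.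
  by rewrite Aop_Aadj c0 big1 // => i _; rewrite mxE mulr0.
have [X [_ XE]] := surj c; have := ip_Aadj c X; rewrite Ac XE.
rewrite /ip mul0mx mxtrace0 => /esym/eqP.
rewrite psumr_eq0 => [/allP h|i _]; last by rewrite -expr2 sqr_ge0.
apply/colP => i; rewrite mxE; have := h i (mem_index_enum i).
by rewrite mulf_eq0 orbb => /eqP.
Qed.

Lemma AAadj_unit : AAadj A \in unitmx.
Proof.
rewrite -row_free_unit; apply: inj_row_free => v vA.
apply: trmx_inj; rewrite trmx0; apply: AAadj_inj.
by rewrite -AAadj_tr -trmx_mul vA trmx0.
Qed.

Lemma Aop_Pop X : Aop A (Pop A X) = Aop A X.
Proof. by rewrite Aop_Aadj mulmxA mulmxV ?AAadj_unit // mul1mx. Qed.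

Lemma Pop_idem X : Pop A (Pop A X) = Pop A X.
Proof. by rewrite {1}/Pop Aop_Pop. Qed.

Lemma Pop_ip X Y : ip (Pop A X) Y = ip (Pop A X) (Pop A Y).
Proof. by rewrite !ip_Aadj Aop_Pop. Qed.

Lemma Pop_orth X Y : ip (Pop A X) (Pperp A Y) = 0.
Proof. by rewrite /Pperp ipDr ipNr -Pop_ip subrr. Qed.

Lemma Pop_sqnorm_le X : sym X -> sqnorm (Pop A X) <= sqnorm X.
Proof.
move=> sX; have -> : sqnorm X = sqnorm (Pop A X + Pperp A X) by rewrite addrC subrK.
rewrite sqnormDl ?Pop_orth ?mulr0 ?addr0 ?lerDl ?sqnorm_ge0 //.
exact: Pop_sym.
Qed.

Lemma Pop_cvg (x : nat -> 'M[R]_n) X : (forall k, sym (x k)) ->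
  x k @[k --> \oo] --> X -> Pop A (x k) @[k --> \oo] --> Pop A X.
Proof.
move=> sx xX; have sX := cvg_sym sx xX.
apply: sqnorm_cvg; apply: squeeze_cvgr (cvg_cst 0) (cvg_sqnorm xX).
by apply: nearW => k; rewrite sqnorm_ge0 -PopB Pop_sqnorm_le //; apply: symB.
Qed.


(** Replacing (X, Y) by (P X + P^perp Y, P^perp X + P Y) swaps the P^perp components and keeps the
    sum; as the two ranges are orthogonal, it keeps the inner product too. Firmness, an inequality
    between [T U - T V] and its complement, thereby passes to [splitting]. *)
Lemma Pop_Pperp_ip X Y :
  ip (Pop A X + Pperp A Y) (X + Y - (Pop A X + Pperp A Y)) = ip X Y.
Proof.
have -> : X + Y - (Pop A X + Pperp A Y) = Pperp A X + Pop A Y.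
  by rewrite /Pperp; mx_ring.
have -> : ip X Y = ip (Pop A X + Pperp A X) (Pop A Y + Pperp A Y).
  by rewrite /Pperp !(addrC (Pop A _)) !subrK.
have := (Pop_orth X X, Pop_orth X Y, Pop_orth Y X, Pop_orth Y Y).
move: (Pop A X) (Pop A Y) (Pperp A X) (Pperp A Y) => P P' Q Q' [] [] [] o1 o2 o3 o4.
by rewrite !ipDl !ipDr o1 o2 (ipC Q' P') o4 (ipC Q P') o3 (ipC Q' Q); ring.
Qed.

Variable T : 'M[R]_n -> 'M[R]_n.
Hypothesis T_sym : forall V, sym V -> sym (T V).
Hypothesis T_firm : forall U V, sym U -> sym V ->
  0 <= ip (T U - T V) (U - V - (T U - T V)).
Hypothesis T_scale : forall (s : R) V, 0 <= s -> sym V -> T (s *: V) = s *: T V.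

(** [V - T V] is [Thetaperp] when [T] is [Theta]. As P is linear, this is (Id + (2P - Id)(2T -
    Id))/2, a Douglas-Rachford operator. *)
Definition splitting V := Pop A (T V) + Pperp A (V - T V).

Lemma splitting_sym V : sym V -> sym (splitting V).
Proof.
move=> sV; have sT := T_sym sV; have sVT := symB sV sT.
by apply: symD; [exact: Pop_sym | apply: symB => //; exact: Pop_sym].
Qed.

Lemma splitting_firm U V : sym U -> sym V ->
  0 <= ip (splitting U - splitting V) (U - V - (splitting U - splitting V)).
Proof.
move=> sU sV; have := T_firm sU sV; rewrite -Pop_Pperp_ip.
have -> : splitting U - splitting V =
    Pop A (T U - T V) + Pperp A (U - V - (T U - T V)).
  by rewrite /splitting /Pperp !PopB; mx_ring.
by rewrite (addrC (T U - T V)) subrK.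
Qed.

Lemma splitting_scale (s : R) V : 0 <= s -> sym V ->
  splitting (s *: V) = s *: splitting V.
Proof.
by move=> s0 sV; rewrite /splitting T_scale // -scalerBr /Pperp !PopZ; mx_ring.
Qed.

Lemma Pop_splitting V : Pop A (splitting V) = Pop A (T V).
Proof. by rewrite /splitting /Pperp PopD PopB !Pop_idem subrr addr0. Qed.

Lemma splitting_iteration y (V : nat -> 'M[R]_n) : sym y -> sym (V 0) ->
  (forall k, V k.+1 = V k + (y - splitting (V k))) ->
  exists X, [/\ sym X,
    Defs.proj (closure [set splitting V | V in @sym R n]) y = y - X,
    V k.+1 - V k @[k --> \oo] --> X &
    T (V k.+1) - T (V k) @[k --> \oo] --> T X].
Proof.
move=> sy sV0 VS.
have [p [X [pP pX MX]]] :=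
  resolvent_limit splitting_sym splitting_firm sy splitting_scale.
have sX := firm_limit_sym pP pX.
have sV k : sym (V k).
  elim: k => // k IH; rewrite VS; apply: symD => //; apply: symB => //.
  exact: splitting_sym.
have VE k : V k = iter k (fun V => V + (y - splitting V)) (V 0).
  by elim: k => [|k IH]; [|rewrite iterS -IH; exact: VS].
pose D k := y - splitting (V k).
have sD k : sym (D k) by apply: symB => //; exact: splitting_sym.
have DE k : V k.+1 - V k = D k by rewrite VS addrC addKr.
have cD : D k @[k --> \oo] --> X.
  rewrite /D; under eq_cvg do rewrite VE.
  exact: (firm_iteration_cvg splitting_sym splitting_firm sy splitting_scale pP pX sV0).
exists X; split=> //.
- exact: (firm_limit_proj splitting_sym splitting_firm sy splitting_scale pP pX).
- by under eq_cvg do rewrite DE.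
have cD1 : D k.+1 @[k --> \oo] --> X by rewrite (cvg_shiftS D).
(* The P-component of T (V k) is that of the increment, hence it is
   asymptotically constant; its complement follows V k itself. *)
have TE k : T (V k.+1) - T (V k) = Pop A (D k - D k.+1) + Pperp A (D k.+1).
  have e1 : D k - D k.+1 = splitting (V k.+1) - splitting (V k).
    by rewrite /D; move: (splitting _) (splitting _) => *; mx_ring.
  have e2 : D k.+1 = (V k.+1 - V k) - (splitting (V k.+1) - splitting (V k)).
    by rewrite DE /D; move: (splitting _) (splitting _) => *; mx_ring.
  have sE U : splitting U = Pop A (T U) + (U - T U) - (Pop A U - Pop A (T U)).
    by rewrite /splitting /Pperp PopB addrA.
  rewrite e1 e2; move: (V k.+1) (V k) => U U'.
  move: (Pop_splitting U) (Pop_splitting U') (sE U) (sE U').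
  move: (splitting U) (splitting U') => S S' p1 p2 E E'.
  rewrite /Pperp !PopB p1 p2 E E'.
  by move: U U' (T U) (T U') (Pop A _) (Pop A _) (Pop A _) (Pop A _) {p1 p2 E E'} => *;
    mx_ring.
(* Applying P to M X = 0 gives P (T X) = 0, and then T X = P^perp X. The vanishing term
   [Pop A (X - X)] is written out to match the limit of [TE]. *)
have -> : T X = Pop A (X - X) + Pperp A X.
  have P0 : Pop A (T X) = 0 by rewrite -Pop_splitting MX -(scale0r 0) PopZ !scale0r.
  move: MX; rewrite /splitting /Pperp P0 PopB P0 add0r subr0 => e.
  apply/eqP; rewrite PopB subrr add0r /Pperp eq_sym -subr_eq0 addrAC.
  by apply/eqP.
under eq_cvg do rewrite TE.
move: D {DE TE} sD cD cD1 => D sD cD cD1.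
have c1 : Pop A (D k - D k.+1) @[k --> \oo] --> Pop A (X - X).
  apply: (@Pop_cvg (fun k => D k - D k.+1)) => [k|]; first exact: symB.
  exact: cvgB cD cD1.
have c2 : Pop A (D k.+1) @[k --> \oo] --> Pop A X.
  by apply: (@Pop_cvg (fun k => D k.+1)).
exact: cvgD c1 (cvgB cD1 c2).
Qed.

End ConstraintProjection.

(** * Limits of the second-order increments *)

Theorem theorem5p5 (R : realType) (n m : nat)
  (A : 'I_m -> 'M[R]_n) (b : 'cV[R]_m) (C : 'M[R]_n) (sigma : R)
  (Zb Hb W0 : 'M[R]_n) :
  (forall i, sym (A i)) -> sym C ->
  (* (A1) A : S^n -> R^m is surjective *)
  (forall c : 'cV[R]_m, exists X, sym X /\ Aop A X = c) ->
  (* (A2) existence of a strictly complementary KKT point *)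
  (exists X y S, KKT A b C X y S /\ (\rank X + \rank S)%N = n) ->
  0 < sigma ->
  Zstar A b C sigma Zb ->
  critcone A Zb Hb ->
  sym W0 ->
  let W := fun k : nat => iter k (fun Wk => Wk + delta2 A Zb Hb Wk) W0 in
  let seqX := fun k : nat => dd2 (@PiP R n) Zb Hb (W k.+1) - dd2 (@PiP R n) Zb Hb (W k) in
  let seqS := fun k : nat => dd2 (@PiN R n) Zb Hb (W k.+1) - dd2 (@PiN R n) Zb Hb (W k) in
  let phiX := lim (seqX @ \oo) in
  let phiS := - sigma^-1 *: lim (seqS @ \oo) in
  [/\ cvg (seqX @ \oo), cvg (seqS @ \oo),
      phiX = Theta Zb Hb (phi A Zb Hb),
      phiS = - sigma^-1 *: Thetaperp Zb Hb (phi A Zb Hb)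
    & phi A Zb Hb = phiX - sigma *: phiS].
Proof.
move=> sA _ surj _ sigma0 [X0 [S0 [[y1 [S1 [_ _ [sX0 _] _ _]]]
  [X2 [y2 [_ _ _ [sS0 _] _]]] ZbE]]] [sH _] sW0.
have sZ : sym Zb by rewrite ZbE; apply/symB/symZ.
have sU := Upsilon_sym sZ sH.
have sT V : sym V -> sym (Theta Zb Hb V) by move=> sV; exact: (sym_Theta sZ sH sV).
have firm U V (sU' : sym U) (sV : sym V) := Theta_firm sZ sH sU' sV.
have scale s V (s0 : 0 <= s) (sV : sym V) := Theta_scale sZ sH s0 sV.
have dP V : sym V -> dd2 (@PiP R n) Zb Hb (V + Upsilon Zb Hb) =
    Theta Zb Hb V + dd2 (@PiP R n) Zb Hb (Upsilon Zb Hb) by rewrite /Theta subrK.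
(* In the variable W - Upsilon the iteration takes the form treated by [splitting_iteration], once
   the second derivative of [PiN] is replaced by the direction minus that of [PiP]. *)
have dE V : sym V -> delta2 A Zb Hb (V + Upsilon Zb Hb) =
    Psi A Zb Hb - splitting A (Theta Zb Hb) V.
  move=> sV; rewrite /Psi /delta2 !dd2_PiN //; last exact: symD.
  rewrite dP // /splitting /Pperp.
  move: (Upsilon _ _) (Theta _ _ _) (dd2 _ _ _ _) => U T D.
  by rewrite !(PopB, PopD); mx_ring.
have sPsi : sym (Psi A Zb Hb).
  have sPop X := Pop_sym sA X.
  have sD := dd2_PiP_sym sZ sH sU.
  rewrite /Psi /delta2 /Pperp dd2_PiN //; apply: symB; first exact/symN/sPop.
  by apply: symB; [exact: symB | exact: sPop].
move=> W seqX seqS phiX phiS.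
have : exists V : nat -> 'M[R]_n, [/\ sym (V 0),
    forall k, V k.+1 = V k + (Psi A Zb Hb - splitting A (Theta Zb Hb) (V k)),
    forall k, sym (V k) & forall k, W k = V k + Upsilon Zb Hb].
  exists (fun k => W k - Upsilon Zb Hb).
  have sW k : sym (W k - Upsilon Zb Hb).
    elim: k => [|k IH]; first exact: symB.
    have -> : W k.+1 = W k + delta2 A Zb Hb (W k) by [].
    rewrite -{2}(subrK (Upsilon Zb Hb) (W k)) dE // addrAC.
    by apply: symD => //; apply: symB => //; exact: splitting_sym.
  split=> // k; last by rewrite subrK.
  have -> : W k.+1 = W k + delta2 A Zb Hb (W k) by [].
  by rewrite -{2}(subrK (Upsilon Zb Hb) (W k)) dE // addrAC.
case=> V [sV0 VS sV WE]; clearbody W.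
have [X [sX XE cV cT]] := splitting_iteration sA surj sT firm scale sPsi sV0 VS.
have phiE : phi A Zb Hb = X.
  (* [Thetaperp] is the identity minus [Theta] on symmetric matrices, so the cone is the closure of
     the range of [splitting]. *)
  rewrite /phi /Kcone (_ : [set _ | _ in _] =
      [set splitting A (Theta Zb Hb) V | V in @sym R n]).
    by rewrite XE; move: (Psi _ _ _) => *; mx_ring.
  apply: eq_imagel => U' sU'; rewrite (Thetaperp_eq sZ sH) //.
have seqXE : seqX = fun k => Theta Zb Hb (V k.+1) - Theta Zb Hb (V k).
  apply/funext => k; rewrite /seqX (WE k.+1) (WE k) (dP _ (sV k.+1)) (dP _ (sV k)).
  move: (Theta Zb Hb (V k.+1)) (Theta Zb Hb (V k)) (dd2 _ _ _ _) => *; mx_ring.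
have cX : seqX @ \oo --> Theta Zb Hb X.
  exact: (eq_ind_r (fun u : nat -> 'M[R]_n => u @ \oo --> Theta Zb Hb X) cT seqXE).
(* The second derivatives of the two projections add up to the direction, and [Upsilon] cancels in
   the differences. *)
have seqSE : seqS = fun k => (V k.+1 - V k) - seqX k.
  apply/funext => k; rewrite /seqS /seqX (WE k.+1) (WE k).
  rewrite (dd2_PiN sZ sH (symD (sV k.+1) sU)) (dd2_PiN sZ sH (symD (sV k) sU)).
  move: (V k.+1) (V k) (Upsilon _ _) => v v' u.
  by move: (dd2 _ _ _ (v + u)) (dd2 _ _ _ (v' + u)) => *; mx_ring.
have cS : seqS @ \oo --> Thetaperp Zb Hb X.
  rewrite (Thetaperp_eq sZ sH sX); apply: (eq_ind_r (fun u : nat -> 'M[R]_n =>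
    u @ \oo --> X - Theta Zb Hb X) _ seqSE).
  exact: cvgB cV cX.
have lX : phiX = Theta Zb Hb X := cvg_lim (@norm_hausdorff _ _) cX.
have lS : lim (seqS @ \oo) = Thetaperp Zb Hb X := cvg_lim (@norm_hausdorff _ _) cS.
rewrite phiE; split.
- exact: (cvgP _ cX).
- exact: (cvgP _ cS).
- exact: lX.
- by rewrite /phiS lS.
rewrite lX /phiS lS (Thetaperp_eq sZ sH sX) scalerA mulrN mulfV ?gt_eqF //.
by move: (Theta _ _ _) => *; mx_ring.
Qed.
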